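(* Let $b,c,d$ be nonzero complex numbers with $|q/(bcd)|<1$, such that no denominator below vanishes. Then the following hold. (1) $$\sum_{n=-\infty}^{\infty}\frac{(b,c,d;q)_n}{(q/b,q/c,q/d;q)_n}\left(\frac{q}{bcd}\right)^n=\frac{(q,\, q/(bc),\,q/(bd),\, q/(cd); q)_{\infty}}{(q/ b,\,q/ c,\, q/ d,\, q/(b c d) ; q)_{\infty}}.$$ (2) $$C_0+\sum_{n=2}^{\infty}\frac{1-q^{2n-1}}{(1-q^{n-1})(1-q^n)}\frac{(b,c,d;q)_n}{(1/b,1/c,1/d;q)_n}\left(\frac{1}{b c d}\right)^n=\frac{(q,\, 1/(bc),\, 1/(bd),\, 1/(cd); q)_{\infty}}{(1 / b,\, 1/ c,\, 1 / d,\, 1 /(b c d) ; q)_{\infty}},$$ where $$C_0:=\frac{2 b c d q-b c d-b c q-b d q-c d q+b+c+d+q-2}{(1-q)(1-b) (1-c) (1-d)}.$$ (3) In particular (the case $b=c=d$ of (2), and the limiting case $b,c,d\to\infty$ of (2), respectively), $$\sum_{n=2}^{\infty}\frac{1-q^{2n-1}}{(1-q^{n-1})(1-q^n)}\frac{(b;q)_n^3}{(1/b;q)_n^3}\left(\frac{1}{b}\right)^{3n}=(q;q)_\infty\frac{(-1 /b; q)_{\infty}^3\,(q/b^2;q^2)_\infty^3}{(1 /b^3; q)_{\infty}}+\frac{-2 b q+b-q+2}{(1-b)(1-q)};$$ and $$\sum_{n=2}^{\infty}\frac{1-q^{2n-1}}{(1-q^{n-1})(1-q^n)}(-1)^nq^{3n(n-1)/2}=(q;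 q)_{\infty}-\frac{1-2q}{1-q}.$$
   Context: $q$ is a complex number with $0<|q|<1$. For $|p|<1$, $(a;p)_\infty=\prod_{j=0}^{\infty}(1-ap^j)$, and for every integer $n$ (possibly negative), $(a;q)_n=(a;q)_\infty/(aq^n;q)_\infty$. Multi-parameter notation: $(a_1,\dots,a_m;q)_n=\prod_{i=1}^m(a_i;q)_n$, also for $n=\infty$. The bilateral sum in (1) is the bilateral basic hypergeometric series ${}_3\psi_3$ with upper parameters $b,c,d$, lower parameters $q/b,q/c,q/d$, and argument $q/(bcd)$.
   Formalization: In (2) and the first identity of (3), the series can diverge under |q/(bcd)|<1 alone; here convergence is asserted when |1/(bcd)|<1 (for (3): |1/b^3|<1), and the identity is asserted whenever the series converges. *)

(* Defs.v *)
From Stdlib Require Import Reals ZArith List Lra Lia.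
From Coquelicot Require Import Coquelicot.
Import ListNotations.
Open Scope C_scope.

(* z^n for an integer n *)
Definition Cpowz (z : C) (n : Z) : C :=
  match n with
  | Z0 => 1
  | Zpos k => z ^ Pos.to_nat k
  | Zneg k => / z ^ Pos.to_nat k
  end.

(* (a;p)_n = (1 - a)(1 - a p)...(1 - a p^(n-1)) *)
Fixpoint qpoch_fin (a p : C) (n : nat) : C :=
  match n with
  | O => 1
  | S m => qpoch_fin a p m * (1 - a * p ^ m)
  end.

(* (a;p)_oo, the limit of the partial products, taken on real and imaginary
   parts; for |p| < 1 it is a genuine limit, see [qpoch_inf_cv] *)
Definition qpoch_inf (a p : C) : C :=
  (real (Lim_seq (fun n => Re (qpoch_fin a p n))),
   real (Lim_seq (fun n => Im (qpoch_fin a p n)))).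

(* (a;q)_n for an integer n.  This is the quotient (a;q)_oo / (a q^n;q)_oo
   with the common factors cancelled, so that it keeps its usual value also
   where that quotient reads 0/0 (a = q^(-k)); see [qpochz_quotient]. *)
Definition qpochz (a q : C) (n : Z) : C :=
  match n with
  | Z0 => 1
  | Zpos k => qpoch_fin a q (Pos.to_nat k)
  | Zneg k => / qpoch_fin (a * Cpowz q n) q (Pos.to_nat k)
  end.

(* (a_1,...,a_m;q)_n and (a_1,...,a_m;q)_oo *)
Definition qpochzs (l : list C) (q : C) (n : Z) : C :=
  fold_right Cmult 1 (map (fun a => qpochz a q n) l).

Definition qpoch_infs (l : list C) (q : C) : C :=
  fold_right Cmult 1 (map (fun a => qpoch_inf a q) l).

(* f(m) + f(m+1) + f(m+2) + ... = s *)
Definition is_series_from (m : nat) (f : nat -> C) (s : C) : Prop :=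
  is_series (V := C_NormedModule) (fun k : nat => f (m + k)%nat) s.

(* a two-sided series converges when both of its halves do *)
Definition is_bilateral_series (f : Z -> C) (s : C) : Prop :=
  exists s1 s2 : C,
    is_series (V := C_NormedModule) (fun k : nat => f (Z.of_nat k)) s1 /\
    is_series (V := C_NormedModule) (fun k : nat => f (- Z.of_nat (S k))%Z) s2 /\
    s = s1 + s2.

Lemma qpoch_fin_bound (a p : C) (n : nat) : (Cmod p < 1)%R ->
  (Cmod (qpoch_fin a p n) <= exp (Cmod a / (1 - Cmod p)))%R.
Proof.
intros Hp.
assert (H0 : (0 <= Cmod p)%R) by apply Cmod_ge_0.
assert (Ha : (0 <= Cmod a)%R) by apply Cmod_ge_0.
assert (H : (Cmod (qpoch_fin a p n)
             <= exp (Cmod a * (1 - Cmod p ^ n) / (1 - Cmod p)))%R).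
{ induction n as [|n IH]; simpl qpoch_fin.
  - rewrite Cmod_1; simpl.
    replace (Cmod a * (1 - 1) / (1 - Cmod p))%R with 0%R by (field; lra).
    rewrite exp_0; lra.
  - rewrite Cmod_mult.
    replace (Cmod a * (1 - Cmod p ^ S n) / (1 - Cmod p))%R
      with (Cmod a * (1 - Cmod p ^ n) / (1 - Cmod p) + Cmod a * Cmod p ^ n)%R
      by (simpl; field; lra).
    rewrite exp_plus.
    apply Rmult_le_compat; try apply Cmod_ge_0; auto.
    apply Rle_trans with (1 + Cmod a * Cmod p ^ n)%R.
    + eapply Rle_trans; [apply Cmod_triangle|].
      rewrite Cmod_1, Cmod_opp, Cmod_mult, Cmod_pow; lra.
    + apply exp_ineq1_le. }
eapply Rle_trans; [exact H|].
destruct (Rle_lt_or_eq_dec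
  (Cmod a * (1 - Cmod p ^ n) / (1 - Cmod p)) (Cmod a / (1 - Cmod p))) as [L|L].
- unfold Rdiv. apply Rmult_le_compat_r.
  + left; apply Rinv_0_lt_compat; lra.
  + assert (0 <= Cmod p ^ n)%R by (apply pow_le; auto). nra.
- left; apply exp_increasing; exact L.
- rewrite L; lra.
Qed.

Lemma Rlim_increments (u : nat -> R) (M r : R) : (0 <= r < 1)%R ->
  (forall n, Rabs (u (S n) - u n) <= M * r ^ n)%R -> ex_finite_lim_seq u.
Proof.
intros Hr Hu.
assert (E : ex_series (fun n => (u (S n) - u n)%R)).
{ apply (ex_series_le (K := R_AbsRing) (V := R_CompleteNormedModule) _
           (fun n => M * r ^ n)%R); [exact Hu|].
  apply (ex_series_scal_l M (fun n => r ^ n)%R).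
  apply ex_series_geom; rewrite Rabs_pos_eq; lra. }
destruct E as [l Hl].
exists (l + u O)%R.
apply is_lim_seq_incr_1.
apply is_lim_seq_ext with (fun n => (sum_n (fun n => u (S n) - u n) n + u O)%R).
- intros n; induction n as [|n IH].
  + rewrite sum_O; ring.
  + rewrite sum_Sn; unfold plus; simpl; simpl in IH; lra.
- apply is_lim_seq_plus'; [exact Hl|apply is_lim_seq_const].
Qed.

Lemma qpoch_fin_increments (a p : C) (n : nat) : (Cmod p < 1)%R ->
  (Cmod (qpoch_fin a p (S n) - qpoch_fin a p n)
   <= exp (Cmod a / (1 - Cmod p)) * Cmod a * Cmod p ^ n)%R.
Proof.
intros Hp.
replace (qpoch_fin a p (S n) - qpoch_fin a p n)
  with (- (qpoch_fin a p n * (a * p ^ n))) by (simpl; ring).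
rewrite Cmod_opp, !Cmod_mult, Cmod_pow, Rmult_assoc.
apply Rmult_le_compat_r.
- apply Rmult_le_pos; [|apply pow_le]; apply Cmod_ge_0.
- apply qpoch_fin_bound; exact Hp.
Qed.

Lemma qpoch_inf_cv_parts (a p : C) : (Cmod p < 1)%R ->
  is_lim_seq (fun n => Re (qpoch_fin a p n)) (Re (qpoch_inf a p)) /\
  is_lim_seq (fun n => Im (qpoch_fin a p n)) (Im (qpoch_inf a p)).
Proof.
intros Hp.
assert (Hr : (0 <= Cmod p < 1)%R) by (split; [apply Cmod_ge_0|exact Hp]).
split; simpl; apply Lim_seq_correct';
  apply (Rlim_increments _ (exp (Cmod a / (1 - Cmod p)) * Cmod a) _ Hr);
  intros n; (eapply Rle_trans; [|apply qpoch_fin_increments; exact Hp]).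
- apply (Rle_trans _ _ _ (Rmax_l _ _)
    (Rmax_Cmod (qpoch_fin a p (S n) - qpoch_fin a p n))).
- apply (Rle_trans _ _ _ (Rmax_r _ _)
    (Rmax_Cmod (qpoch_fin a p (S n) - qpoch_fin a p n))).
Qed.

Lemma qpoch_inf_cv (a p : C) : (Cmod p < 1)%R ->
  filterlim (qpoch_fin a p) eventually (locally (qpoch_inf a p)).
Proof.
intros Hp; destruct (qpoch_inf_cv_parts a p Hp) as [H1 H2].
intros P [e He].
destruct (proj1 (is_lim_seq_Reals _ _) H1 e (cond_pos e)) as [N1 HN1].
destruct (proj1 (is_lim_seq_Reals _ _) H2 e (cond_pos e)) as [N2 HN2].
exists (max N1 N2); intros n Hn.
apply He; split; [apply HN1|apply HN2]; lia.
Qed.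

Lemma qpoch_fin_split (a p : C) (m n : nat) :
  qpoch_fin a p (m + n) = qpoch_fin a p m * qpoch_fin (a * p ^ m) p n.
Proof.
induction n as [|n IH].
- rewrite Nat.add_0_r; simpl; ring.
- rewrite Nat.add_succ_r; simpl; rewrite IH, Cpow_add_r; ring.
Qed.

Lemma qpoch_inf_split (a p : C) (m : nat) : (Cmod p < 1)%R ->
  qpoch_inf a p = qpoch_fin a p m * qpoch_inf (a * p ^ m) p.
Proof.
intros Hp.
destruct (qpoch_inf_cv_parts (a * p ^ m) p Hp) as [H1 H2].
set (u := qpoch_fin a p m).
unfold qpoch_inf at 1; apply injective_projections; simpl.
- rewrite <- (Lim_seq_incr_n _ m).
  rewrite (is_lim_seq_unique _
    (Re u * Re (qpoch_inf (a * p ^ m) p) - Im u * Im (qpoch_inf (a * p ^ m) p))%R).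
  { reflexivity. }
  apply is_lim_seq_ext with (fun n => Re u * Re (qpoch_fin (a * p ^ m) p n)
                                - Im u * Im (qpoch_fin (a * p ^ m) p n))%R.
  + intros n; rewrite Nat.add_comm, qpoch_fin_split; reflexivity.
  + apply is_lim_seq_minus';
      [apply (is_lim_seq_scal_l _ (Re u) _ H1)|apply (is_lim_seq_scal_l _ (Im u) _ H2)].
- rewrite <- (Lim_seq_incr_n _ m).
  rewrite (is_lim_seq_unique _
    (Re u * Im (qpoch_inf (a * p ^ m) p) + Im u * Re (qpoch_inf (a * p ^ m) p))%R).
  { reflexivity. }
  apply is_lim_seq_ext with (fun n => Re u * Im (qpoch_fin (a * p ^ m) p n)
                                + Im u * Re (qpoch_fin (a * p ^ m) p n))%R.
  + intros n; rewrite Nat.add_comm, qpoch_fin_split; reflexivity.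
  + apply is_lim_seq_plus';
      [apply (is_lim_seq_scal_l _ (Re u) _ H2)|apply (is_lim_seq_scal_l _ (Im u) _ H1)].
Qed.

Lemma qpochz_quotient (a q : C) (n : Z) : q <> 0 -> (Cmod q < 1)%R ->
  qpoch_inf (a * Cpowz q n) q <> 0 ->
  qpochz a q n = qpoch_inf a q / qpoch_inf (a * Cpowz q n) q.
Proof.
intros Hq0 Hq; destruct n as [|k|k]; unfold qpochz; cbn [Cpowz].
- rewrite Cmult_1_r; intros H; field; exact H.
- intros H; rewrite (qpoch_inf_split a q (Pos.to_nat k) Hq); field; exact H.
- set (m := Pos.to_nat k).
  rewrite (qpoch_inf_split (a * / q ^ m) q m Hq).
  replace (a * / q ^ m * q ^ m) with a by (field; apply Cpow_nz; exact Hq0).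
  intros H.
  assert (H1 : qpoch_fin (a * / q ^ m) q m <> 0)
    by (intros E; apply H; rewrite E; ring).
  assert (H2 : qpoch_inf a q <> 0) by (intros E; apply H; rewrite E; ring).
  field; split; assumption.
Qed.

(* Main.v *)
(* Rogers' very-well-poised 6phi5 sum with parameters a, b, c, d is proved by
   shifting a to a q: the terms s_n(a) satisfy
   s_n(a) - K(a) s_n(a q) = g_n(a) - g_(n-1)(a) with an explicit g, so the sums
   satisfy S(a) = K(a) S(a q), and S(a q^k) -> 1 as k -> oo.
   Identity (1) is the case a = 1 with the terms n and -n put together.
   Identity (2) is the case a = 1/q after division by 1 - a q, which vanishes
   there; the same telescoping reduces it to a = 1.  In (2) the remainder of the
   telescoping is a bounded multiple of the next term, so it tends to 0 whenever
   the series converges, even if |1/(bcd)| >= 1.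
   Everything is written in x = 1/b, y = 1/c, z = 1/d, which makes the limiting
   case b, c, d -> oo of (3) the case x = y = z = 0. *)
Require Import Defs.
From Stdlib Require Import Reals ZArith List Lra Lia.
From Coquelicot Require Import Coquelicot.
Import ListNotations.
Open Scope C_scope.

(** * Limits and sums of complex sequences *)

(** Going from a to a q multiplies the n-th term by q^n times factors that stay bounded, so all
    terms of S(a q^k) except the one at n = 0 die out. To turn this into a limit, every estimate has
    to be uniform in the shift k, in particular the lower bounds for denominators (a q^(k+1) x;
    q)_n. At a = 1/q Rogers' identity degenerates to 0 = 0: the product contains (1;q)_oo, the terms
    n = 0 and n = 1 are 1 and -1, and all later terms contain the factor 1 - a q. Instead of a limit
    a -> 1/q, the quotients by 1 - a q are written down explicitly and the telescoping is verified
    again for them. There the condition |a q x y z| < 1 would read |x y z| < 1, while the hypothesis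
    |q x y z| < 1 is exactly the one for a = 1; hence the separate treatment of the remainder. *)

Definition Ccv (u : nat -> C) (l : C) : Prop :=
  is_lim_seq (fun n => Cmod (u n - l)) 0%R.

(** Neighbourhoods in [C_UniformSpace] are coordinatewise squares, so the two notions agree up to
    the factor sqrt 2 between the modulus and the larger coordinate. [Ccv] reduces complex limits to
    squeezing real sequences. *)
Lemma Ccv_filterlim (u : nat -> C) (l : C) :
  Ccv u l <-> filterlim u eventually (locally (T := C_UniformSpace) l).
Proof.
split.
- intros H; apply filterlim_locally; intros eps.
  destruct (proj1 (is_lim_seq_Reals _ _) H eps (cond_pos eps)) as [N HN].
  exists N; intros n Hn; specialize (HN n Hn); unfold Rdist in HN.
  rewrite Rminus_0_r, Rabs_pos_eq in HN by apply Cmod_ge_0.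
  pose proof (Rmax_Cmod (u n - l)) as HM.
  split; (eapply Rle_lt_trans; [|exact HN]); (eapply Rle_trans; [|exact HM]).
  + apply Rmax_l.
  + apply Rmax_r.
- intros H; apply is_lim_seq_Reals; intros e He.
  (* Halving e absorbs the factor sqrt 2 <= 2. *)
  assert (He2 : (0 < e / 2)%R) by lra.
  destruct (proj1 (filterlim_locally _ _) H (mkposreal _ He2)) as [N HN].
  exists N; intros n Hn; destruct (HN n Hn) as [B1 B2].
  unfold Rdist; rewrite Rminus_0_r, Rabs_pos_eq by apply Cmod_ge_0.
  eapply Rle_lt_trans; [apply Cmod_2Rmax|].
  assert (HM : (Rmax (Rabs (fst (u n - l)%C)) (Rabs (snd (u n - l)%C)) < e / 2)%R)
    by (apply Rmax_lub_lt; [exact B1|exact B2]).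
  assert (Hs : (sqrt 2 <= 2)%R).
  { rewrite <- (sqrt_square 2) at 2 by lra. apply sqrt_le_1; lra. }
  pose proof (sqrt_pos 2) as Hp.
  assert (0 <= Rmax (Rabs (fst (u n - l)%C)) (Rabs (snd (u n - l)%C)))%R
    by (eapply Rle_trans; [apply Rabs_pos|apply Rmax_l]).
  nra.
Qed.

Definition Csum (f : nat -> C) (n : nat) : C := sum_n (G := C_AbelianMonoid) f n.

Lemma Csum_O (f : nat -> C) : Csum f O = f O.
Proof. exact (sum_O (G := C_AbelianMonoid) f). Qed.

Lemma Csum_S (f : nat -> C) (n : nat) : Csum f (S n) = Csum f n + f (S n).
Proof. exact (sum_Sn (G := C_AbelianMonoid) f n). Qed.

Lemma Csum_ext (f g : nat -> C) : (forall n, f n = g n) -> forall n, Csum f n = Csum g n.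
Proof. intros H n; unfold Csum; apply sum_n_ext; exact H. Qed.

Lemma Ccv_is_series (f : nat -> C) (s : C) :
  is_series (V := C_NormedModule) f s <-> Ccv (Csum f) s.
Proof. split; apply Ccv_filterlim. Qed.

Lemma Ccv_squeeze (u : nat -> C) (l : C) (e : nat -> R) :
  (forall n, (Cmod (u n - l) <= e n)%R) -> is_lim_seq e 0%R -> Ccv u l.
Proof.
intros H He.
apply (is_lim_seq_le_le (fun _ => 0%R) _ e);
  [intros n; split; [apply Cmod_ge_0|apply H]|apply is_lim_seq_const|exact He].
Qed.

Lemma Ccv_unique (u : nat -> C) (l m : C) : Ccv u l -> Ccv u m -> l = m.
Proof.
intros Hl Hm.
apply (filterlim_locally_unique (V := C_NormedModule) (F := eventually) u);
  apply Ccv_filterlim; assumption.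
Qed.

Lemma Ccv_ext (u v : nat -> C) (l : C) :
  (forall n, u n = v n) -> Ccv u l -> Ccv v l.
Proof.
intros E; apply is_lim_seq_ext; intros n; rewrite E; reflexivity.
Qed.

Lemma Ccv_const (c : C) : Ccv (fun _ => c) c.
Proof.
apply (is_lim_seq_ext (fun _ => 0%R)); [|apply is_lim_seq_const].
intros n; replace (c - c) with (RtoC 0) by ring; rewrite Cmod_0; reflexivity.
Qed.

Lemma Ccv_plus (u v : nat -> C) (l m : C) :
  Ccv u l -> Ccv v m -> Ccv (fun n => u n + v n) (l + m).
Proof.
intros Hu Hv.
apply (Ccv_squeeze _ _ (fun n => Cmod (u n - l) + Cmod (v n - m))%R).
- intros n; replace (u n + v n - (l + m)) with ((u n - l) + (v n - m)) by ring.
  apply Cmod_triangle.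
- replace 0%R with (0 + 0)%R by ring; apply is_lim_seq_plus'; assumption.
Qed.

Lemma Ccv_mult (u v : nat -> C) (l m : C) :
  Ccv u l -> Ccv v m -> Ccv (fun n => u n * v n) (l * m).
Proof.
intros Hu Hv.
apply (Ccv_squeeze _ _ (fun n => Cmod (u n - l) * Cmod (v n - m)
  + Cmod m * Cmod (u n - l) + Cmod l * Cmod (v n - m))%R).
- intros n.
  replace (u n * v n - l * m)
    with ((u n - l) * (v n - m) + m * (u n - l) + l * (v n - m)) by ring.
  rewrite <- !Cmod_mult.
  eapply Rle_trans; [apply Cmod_triangle|apply Rplus_le_compat_r, Cmod_triangle].
- replace 0%R with (0 * 0 + Cmod m * 0 + Cmod l * 0)%R by ring.
  apply is_lim_seq_plus'; [apply is_lim_seq_plus'|].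
  + apply is_lim_seq_mult'; assumption.
  + apply (is_lim_seq_scal_l _ (Cmod m) _ Hu).
  + apply (is_lim_seq_scal_l _ (Cmod l) _ Hv).
Qed.

Lemma Ccv_incr (u : nat -> C) (l : C) (m : nat) :
  Ccv (fun n => u (n + m)%nat) l <-> Ccv u l.
Proof.
unfold Ccv; symmetry; apply (is_lim_seq_incr_n (fun n => Cmod (u n - l)) m).
Qed.

(** * Infinite products *)

Lemma Ccv_qpoch_fin (a p : C) : (Cmod p < 1)%R ->
  Ccv (qpoch_fin a p) (qpoch_inf a p).
Proof. intros Hp; apply Ccv_filterlim, qpoch_inf_cv, Hp. Qed.

Lemma Ccv_bound (u : nat -> C) (l : C) (B : R) :
  (forall n, (Cmod (u n) <= B)%R) -> Ccv u l -> (Cmod l <= B)%R.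
Proof.
intros HB Hu.
apply (is_lim_seq_le (fun _ => Cmod l) (fun n => Cmod (u n - l) + B)%R (Cmod l) B).
- intros n; replace l with (- (u n - l) + u n) at 1 by ring.
  eapply Rle_trans; [apply Cmod_triangle|]; rewrite Cmod_opp.
  apply Rplus_le_compat_l, HB.
- apply is_lim_seq_const.
- replace (Finite B) with (Finite (0 + B)) by (f_equal; ring).
  apply is_lim_seq_plus'; [exact Hu|apply is_lim_seq_const].
Qed.

(** * Bounds uniform in the shift, and geometric decay *)

Lemma Cmod_pow_le_1 (q : C) (n : nat) : (Cmod q < 1)%R -> (Cmod (q ^ n) <= 1)%R.
Proof.
intros Hq; rewrite Cmod_pow, <- (pow1 n); apply pow_incr.
split; [apply Cmod_ge_0|lra].
Qed.

Lemma qpoch_fin_shift_bound (a q : C) (k n : nat) : (Cmod q < 1)%R ->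
  (Cmod (qpoch_fin (a * q ^ k) q n) <= exp (Cmod a / (1 - Cmod q)))%R.
Proof.
intros Hq; eapply Rle_trans; [apply qpoch_fin_bound, Hq|].
assert (H : (Cmod (a * q ^ k) / (1 - Cmod q) <= Cmod a / (1 - Cmod q))%R).
{ apply Rmult_le_compat_r; [left; apply Rinv_0_lt_compat; lra|].
  rewrite Cmod_mult; rewrite <- (Rmult_1_r (Cmod a)) at 2.
  apply Rmult_le_compat_l; [apply Cmod_ge_0|apply Cmod_pow_le_1, Hq]. }
destruct H as [H|H]; [left; apply exp_increasing, H|rewrite H; lra].
Qed.

Lemma qpoch_fin_neq0 (a q : C) (n : nat) : (Cmod q < 1)%R ->
  qpoch_inf a q <> 0 -> qpoch_fin a q n <> 0.
Proof.
intros Hq H E; apply H; rewrite (qpoch_inf_split a q n Hq), E; ring.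
Qed.

Lemma qpoch_inf_shift_neq0 (a q : C) (n : nat) : (Cmod q < 1)%R ->
  qpoch_inf a q <> 0 -> qpoch_inf (a * q ^ n) q <> 0.
Proof.
intros Hq H E; apply H; rewrite (qpoch_inf_split a q n Hq), E; ring.
Qed.

(** In (a;q)_oo = (a;q)_k (a q^k;q)_n (a q^(k+n);q)_oo the outer factors have modulus at most E, so
    the middle one has modulus at least |(a;q)_oo| / E^2, whatever k and n are. *)
Lemma qpoch_fin_shift_lower (a q : C) : (Cmod q < 1)%R -> qpoch_inf a q <> 0 ->
  exists M : R, (0 < M)%R /\
  forall k n, (Cmod (/ qpoch_fin (a * q ^ k) q n) <= M)%R.
Proof.
intros Hq H.
set (E := exp (Cmod a / (1 - Cmod q))).
assert (HE : (0 < E)%R) by apply exp_pos.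
assert (HI : (0 < Cmod (qpoch_inf a q))%R) by apply Cmod_gt_0, H.
exists (E * E / Cmod (qpoch_inf a q))%R; split.
{ apply Rmult_lt_0_compat; [nra|apply Rinv_0_lt_compat, HI]. }
intros k n.
pose proof (qpoch_fin_neq0 (a * q ^ k) q n Hq (qpoch_inf_shift_neq0 a q k Hq H)) as Hn.
rewrite Cmod_inv by exact Hn.
set (F := Cmod (qpoch_fin (a * q ^ k) q n)).
assert (HF : (0 < F)%R) by apply Cmod_gt_0, Hn.
assert (L : (Cmod (qpoch_inf a q) <= E * (F * E))%R).
{ rewrite (qpoch_inf_split a q k Hq), (qpoch_inf_split (a * q ^ k) q n Hq).
  rewrite !Cmod_mult; fold F.
  apply Rmult_le_compat; [apply Cmod_ge_0| | |].
  - apply Rmult_le_pos; [lra|apply Cmod_ge_0].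
  - apply qpoch_fin_bound, Hq.
  - apply Rmult_le_compat_l; [lra|].
    rewrite <- Cmult_assoc, <- Cpow_add_r.
    apply (Ccv_bound (qpoch_fin (a * q ^ (k + n)) q)); [|apply Ccv_qpoch_fin, Hq].
    intros m; apply qpoch_fin_shift_bound, Hq. }
apply (Rmult_le_reg_l (F * Cmod (qpoch_inf a q))); [nra|].
replace (F * Cmod (qpoch_inf a q) * / F)%R with (Cmod (qpoch_inf a q)) by (field; lra).
replace (F * Cmod (qpoch_inf a q) * (E * E / Cmod (qpoch_inf a q)))%R
  with (E * (F * E))%R by (field; lra).
exact L.
Qed.

(** The ratio test as an explicit bound from index 0 on: past some N the ratios stay below the
    midpoint [rho] of |l| and 1, and K absorbs the finitely many earlier terms. *)
Lemma geometric_decay (u r : nat -> C) (l : C) :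
  (forall n, u (S n) = u n * r n) -> Ccv r l -> (Cmod l < 1)%R ->
  exists K rho : R, (0 <= K)%R /\ (0 <= rho < 1)%R /\
  forall n, (Cmod (u n) <= K * rho ^ n)%R.
Proof.
intros Hu Hr Hl.
pose proof (Cmod_ge_0 l) as Hl0.
set (rho := ((1 + Cmod l) / 2)%R).
assert (Hrho : (0 < rho < 1)%R) by (unfold rho; lra).
assert (He : (0 < (1 - Cmod l) / 2)%R) by lra.
destruct (proj1 (is_lim_seq_Reals _ _) Hr _ He) as [N HN].
assert (HrN : forall n, (N <= n)%nat -> (Cmod (r n) <= rho)%R).
{ intros n Hn; specialize (HN n Hn); unfold Rdist in HN.
  rewrite Rminus_0_r, Rabs_pos_eq in HN by apply Cmod_ge_0.
  replace (r n) with ((r n - l) + l) by ring.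
  eapply Rle_trans; [apply Cmod_triangle|unfold rho; lra]. }
assert (HK : forall m, exists K, (0 <= K)%R /\
  forall n, (n <= m)%nat -> (Cmod (u n) <= K * rho ^ n)%R).
{ induction m as [|m [K [HK IH]]].
  - exists (Cmod (u O)); split; [apply Cmod_ge_0|].
    intros n Hn; replace n with O by lia; simpl; lra.
  - assert (Hp : (0 < rho ^ S m)%R) by (apply pow_lt; lra).
    assert (Hd : (0 <= Cmod (u (S m)) / rho ^ S m)%R).
    { apply Rmult_le_pos; [apply Cmod_ge_0|left; apply Rinv_0_lt_compat, Hp]. }
    exists (K + Cmod (u (S m)) / rho ^ S m)%R; split; [lra|].
    intros n Hn; destruct (Nat.eq_dec n (S m)) as [->|Hne].
    + replace ((K + Cmod (u (S m)) / rho ^ S m) * rho ^ S m)%R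
        with (K * rho ^ S m + Cmod (u (S m)))%R by (field; lra).
      nra.
    + eapply Rle_trans; [apply IH; lia|].
      apply Rmult_le_compat_r; [apply pow_le|]; lra. }
destruct (HK N) as [K [HK0 HKN]].
exists K, rho; split; [exact HK0|split; [lra|]].
induction n as [|n IH]; [apply HKN; lia|].
destruct (le_lt_dec (S n) N) as [L|L]; [apply HKN, L|].
rewrite Hu, Cmod_mult.
replace (K * rho ^ S n)%R with (K * rho ^ n * rho)%R by (simpl; ring).
apply Rmult_le_compat; try apply Cmod_ge_0; [exact IH|apply HrN; lia].
Qed.

Lemma Ccv_pow_0 (q : C) : (Cmod q < 1)%R -> Ccv (fun n => q ^ n) 0.
Proof.
intros Hq.
apply (Ccv_squeeze _ _ (fun n => Cmod q ^ n)%R).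
- intros n; replace (q ^ n - 0) with (q ^ n) by ring; rewrite Cmod_pow; lra.
- apply is_lim_seq_geom; rewrite Rabs_pos_eq; [exact Hq|apply Cmod_ge_0].
Qed.

Lemma Ccv_geometric (u : nat -> C) (K rho : R) : (0 <= rho < 1)%R ->
  (forall n, (Cmod (u n) <= K * rho ^ n)%R) -> Ccv u 0.
Proof.
intros Hr Hu; apply (Ccv_squeeze _ _ (fun n => K * rho ^ n)%R).
- intros n; replace (u n - 0) with (u n) by ring; apply Hu.
- replace (Finite 0) with (Rbar_mult K 0) by (simpl; f_equal; ring).
  apply is_lim_seq_scal_l, is_lim_seq_geom; rewrite Rabs_pos_eq; lra.
Qed.

(** * Rogers' sum *)

(* [x^n (1/x;q)_n], written so that it makes sense at [x = 0], which is the
   limit [1/x -> oo]. *)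
Fixpoint hpoch (x q : C) (n : nat) : C :=
  match n with
  | O => 1
  | S m => hpoch x q m * (x - q ^ m)
  end.

Lemma hpoch_inv (b q : C) (n : nat) : b <> 0 ->
  hpoch (1 / b) q n = qpoch_fin b q n * (1 / b) ^ n.
Proof.
intros Hb; induction n as [|n IH]; [simpl; ring|].
cbn [hpoch qpoch_fin]; rewrite IH, Cpow_S; field; exact Hb.
Qed.

Definition hpoch3 (x y z q : C) (n : nat) : C :=
  hpoch x q n * hpoch y q n * hpoch z q n.

(** The ratio of consecutive terms is w (x - q^n)(y - q^n)(z - q^n), with limit w x y z. *)
Lemma hpoch3_decay (x y z w q : C) : (Cmod q < 1)%R ->
  (Cmod (w * (x * y * z)) < 1)%R ->
  exists K rho : R, (0 <= K)%R /\ (0 <= rho < 1)%R /\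
  forall n, (Cmod (hpoch3 x y z q n * w ^ n) <= K * rho ^ n)%R.
Proof.
intros Hq H.
apply (geometric_decay _
  (fun n => w * ((x + - q ^ n) * (y + - q ^ n) * (z + - q ^ n))) (w * (x * y * z))); [| |exact H].
- intros n; unfold hpoch3; cbn [hpoch]; rewrite Cpow_S; ring.
- assert (Hm : forall v, Ccv (fun n => v + - q ^ n) v).
  { intros v; replace v with (v + (- (1)) * 0) at 1 by ring.
    apply (Ccv_ext (fun n => v + (- (1)) * q ^ n)); [intros n; ring|].
    apply Ccv_plus; [apply Ccv_const|].
    apply Ccv_mult; [apply Ccv_const|apply Ccv_pow_0, Hq]. }
  apply Ccv_mult; [apply Ccv_const|].
  apply Ccv_mult; [apply Ccv_mult|]; apply Hm.
Qed.

(* [(1 - a q^(2n)) (a;q)_n / ((1 - a) (q;q)_n)] with the factor [1 - a]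
   cancelled, so that [a = 1] is allowed. *)
Definition vwp (a q : C) (n : nat) : C :=
  match n with
  | O => 1
  | S m => qpoch_fin (a * q) q m * (1 - a * q ^ (2 * n)) / qpoch_fin q q n
  end.

(** With b = 1/x, c = 1/y, d = 1/z this is the n-th term of the very-well-poised 6phi5 with argument
    a q/(bcd): the powers x^n, y^n, z^n of the argument sit inside [hpoch3], and a q x = a q/b. *)
Definition rogers_term (x y z q a : C) (n : nat) : C :=
  vwp a q n * (hpoch3 x y z q n * (a * q) ^ n)
  / (qpoch_fin (a * q * x) q n * qpoch_fin (a * q * y) q n * qpoch_fin (a * q * z) q n).

(** The telescoping certificate g_n. It is the term of index n + 1 times the rational factor -(1 -
    q^(n+1)) / (1 - a q^(2n+2)) times the last quotient, with the very-well-poised factor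
    cancelled. *)
Definition rogers_rest (x y z q a : C) (n : nat) : C :=
  - (qpoch_fin (a * q) q n / qpoch_fin q q n)
  * (hpoch3 x y z q (S n) * (a * q) ^ S n)
  / (qpoch_fin (a * q * x) q (S n) * qpoch_fin (a * q * y) q (S n)
     * qpoch_fin (a * q * z) q (S n))
  * ((1 - a * q * (a * q) * (x * y * z) * q ^ n) / (1 - a * q * (x * y * z))).

(** K(a), the quotient of the product side at a by the product side at a q. *)
Definition rogers_ratio (x y z q a : C) : C :=
  (1 - a * q) * (1 - a * q * (x * y)) * (1 - a * q * (x * z)) * (1 - a * q * (y * z))
  / ((1 - a * q * x) * (1 - a * q * y) * (1 - a * q * z) * (1 - a * q * (x * y * z))).

(** Both sides are (a;q)_(n+1), with the first or the last factor split off. *)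
Lemma qpoch_fin_shift (a q : C) (n : nat) :
  (1 - a) * qpoch_fin (a * q) q n = qpoch_fin a q n * (1 - a * q ^ n).
Proof.
replace (qpoch_fin (a * q) q n) with (qpoch_fin (a * q ^ 1) q n) by (f_equal; ring).
change (qpoch_fin a q n * (1 - a * q ^ n)) with (qpoch_fin a q (1 + n)).
rewrite (qpoch_fin_split a q 1 n); simpl; ring.
Qed.

(** The telescoping relation after clearing the common factors, with V = q^(N+1) as a free variable.
    The four products come, in order, from s_(N+1)(a), g_N, K(a) s_(N+1)(a q) and g_(N+1). *)
Lemma rogers_certificate (a q x y z V : C) :
  (1 - a * V * V) * (1 - a * q * (x * y * z))
     * ((1 - a * q * x * V) * (1 - a * q * y * V) * (1 - a * q * z * V))
  - (1 - V) * ((1 - a * q * x * V) * (1 - a * q * y * V) * (1 - a * q * z * V))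
     * (1 - a * (a * q) * (x * y * z) * V)
  = V * (1 - a * q * V * V) * (1 - a * V)
     * ((1 - a * q * (x * y)) * (1 - a * q * (x * z)) * (1 - a * q * (y * z)))
    - a * q * (1 - a * V) * ((x - V) * (y - V) * (z - V))
      * (1 - a * q * (a * q) * (x * y * z) * V).
Proof. ring. Qed.

Lemma rogers_step (x y z q a : C) (N : nat) :
  (forall n, qpoch_fin q q n <> 0) ->
  (forall n, qpoch_fin (a * q * x) q n <> 0) ->
  (forall n, qpoch_fin (a * q * y) q n <> 0) ->
  (forall n, qpoch_fin (a * q * z) q n <> 0) ->
  1 - a * q * (x * y * z) <> 0 ->
  Csum (rogers_term x y z q a) N
  = rogers_ratio x y z q a
      * Csum (rogers_term x y z q (a * q)) N
    + rogers_rest x y z q a N.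
Proof.
intros Hq Hx Hy Hz Hw.
assert (H1 : forall b, (forall n, qpoch_fin b q n <> 0) ->
  forall n, 1 - b * q ^ n <> 0).
{ intros b Hb n E; apply (Hb (S n)); cbn [qpoch_fin]; rewrite E; ring. }
assert (H0 : forall b, (forall n, qpoch_fin b q n <> 0) -> 1 - b <> 0).
{ intros b Hb E; apply (Hb 1%nat); simpl; rewrite Cmult_1_r, E; ring. }
pose proof (H0 _ Hx) as Hx0; pose proof (H0 _ Hy) as Hy0; pose proof (H0 _ Hz) as Hz0.
induction N as [|N IH].
- rewrite !Csum_O; unfold rogers_term, rogers_ratio, rogers_rest, hpoch3; simpl.
  field; repeat split; try assumption; try (rewrite Cmult_1_r; assumption).
- rewrite !Csum_S, IH.
  enough (E : rogers_term x y z q a (S N) + rogers_rest x y z q a N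
    = rogers_ratio x y z q a * rogers_term x y z q (a * q) (S N)
      + rogers_rest x y z q a (S N)).
  { transitivity (rogers_ratio x y z q a
      * Csum (rogers_term x y z q (a * q)) N
      + (rogers_term x y z q a (S N) + rogers_rest x y z q a N)); [ring|].
    rewrite E; ring. }
  assert (Hs : forall b, 1 - b <> 0 -> forall n,
    qpoch_fin (b * q) q n = qpoch_fin b q n * (1 - b * q ^ n) / (1 - b)).
  { intros b Hb n; rewrite <- qpoch_fin_shift; field; exact Hb. }
  unfold rogers_term, rogers_rest, rogers_ratio, vwp.
  replace (q ^ (2 * S N)) with (q ^ S N * q ^ S N)
    by (rewrite <- Cpow_add_r; f_equal; lia).
  replace (hpoch3 x y z q (S (S N))) with (hpoch3 x y z q (S N)
    * ((x - q ^ S N) * (y - q ^ S N) * (z - q ^ S N)))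
    by (unfold hpoch3; simpl; ring).
  replace ((a * q) ^ S (S N)) with ((a * q) ^ S N * (a * q)) by (simpl; ring).
  replace ((a * q * q) ^ S N) with ((a * q) ^ S N * q ^ S N)
    by (rewrite <- Cpow_mult_l; reflexivity).
  replace (1 - a * q * (a * q) * (x * y * z) * q ^ N)
    with (1 - a * (a * q) * (x * y * z) * q ^ S N) by (simpl; ring).
  replace (a * q * q * x) with (a * q * x * q) by ring.
  replace (a * q * q * y) with (a * q * y * q) by ring.
  replace (a * q * q * z) with (a * q * z * q) by ring.
  rewrite (Hs _ Hx0), (Hs _ Hy0), (Hs _ Hz0).
  change (qpoch_fin (a * q * x) q (S (S N)))
    with (qpoch_fin (a * q * x) q (S N) * (1 - a * q * x * q ^ S N)).
  change (qpoch_fin (a * q * y) q (S (S N)))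
    with (qpoch_fin (a * q * y) q (S N) * (1 - a * q * y * q ^ S N)).
  change (qpoch_fin (a * q * z) q (S (S N)))
    with (qpoch_fin (a * q * z) q (S N) * (1 - a * q * z * q ^ S N)).
  (* [HA] is the only link between (a q;q)_N and (a q^2;q)_N; once it is recorded, all factorials
     become opaque variables. *)
  pose proof (qpoch_fin_shift (a * q) q N) as HA.
  change (qpoch_fin (a * q) q (S N)) with (qpoch_fin (a * q) q N * (1 - a * q * q ^ N)).
  change (qpoch_fin q q (S N)) with (qpoch_fin q q N * (1 - q ^ S N)).
  replace (1 - a * q * q ^ N) with (1 - a * q ^ S N) in * by (simpl; ring).
  pose proof (Hq N) as HqN.
  pose proof (H1 _ Hq N) as HqV; change (q * q ^ N) with (q ^ S N) in HqV.
  pose proof (Hx (S N)) as HX; pose proof (H1 _ Hx (S N)) as HxV.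
  pose proof (Hy (S N)) as HY; pose proof (H1 _ Hy (S N)) as HyV.
  pose proof (Hz (S N)) as HZ; pose proof (H1 _ Hz (S N)) as HzV.
  set (X := qpoch_fin (a * q * x) q (S N)) in *.
  set (Y := qpoch_fin (a * q * y) q (S N)) in *.
  set (Z := qpoch_fin (a * q * z) q (S N)) in *.
  set (Q := qpoch_fin q q N) in *.
  set (A := qpoch_fin (a * q) q N) in *.
  set (A2 := qpoch_fin (a * q * q) q N) in *.
  set (H := hpoch3 x y z q (S N)) in *.
  set (P := (a * q) ^ S N) in *.
  set (V := q ^ S N) in *.
  (* [F] is what the four terms share over their common denominator, apart from (a q;q)_N or (1 - a
     q)(a q^2;q)_N. *)
  set (F := H * P / (Q * (1 - V) * (X * Y * Z) * (1 - a * q * (x * y * z))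
    * ((1 - a * q * x * V) * (1 - a * q * y * V) * (1 - a * q * z * V)))).
  transitivity (A * F *
    ((1 - a * V * V) * (1 - a * q * (x * y * z))
     * ((1 - a * q * x * V) * (1 - a * q * y * V) * (1 - a * q * z * V))
     - (1 - V) * ((1 - a * q * x * V) * (1 - a * q * y * V) * (1 - a * q * z * V))
      * (1 - a * (a * q) * (x * y * z) * V))).
  { unfold F; field; repeat split; assumption. }
  transitivity ((1 - a * q) * A2 * F * V * (1 - a * q * V * V)
     * ((1 - a * q * (x * y)) * (1 - a * q * (x * z)) * (1 - a * q * (y * z)))
    + A * F * (- (a * q) * (1 - a * V) * ((x - V) * (y - V) * (z - V))
      * (1 - a * q * (a * q) * (x * y * z) * V))).
  { rewrite HA, rogers_certificate; ring. }
  unfold F; field; repeat split; assumption.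
Qed.

(** * Nonvanishing of infinite products *)

Lemma qpoch_fin_lower (a p : C) (n : nat) : (Cmod p < 1)%R ->
  (Cmod a / (1 - Cmod p) <= 1 / 2)%R -> (1 / 2 <= Cmod (qpoch_fin a p n))%R.
Proof.
intros Hp Ha.
pose proof (Cmod_ge_0 p) as Hp0; pose proof (Cmod_ge_0 a) as Ha0.
set (s := (Cmod a / (1 - Cmod p))%R) in *.
assert (Hs : Cmod a = (s * (1 - Cmod p))%R) by (unfold s; field; lra).
assert (Hs0 : (0 <= s)%R).
{ apply Rmult_le_pos; [exact Ha0|left; apply Rinv_0_lt_compat; lra]. }
clearbody s.
(* Weierstrass' inequality: a product of factors 1 - u_j is at least 1 minus the sum of the |u_j|,
   here the geometric sum s (1 - |p|^n). *)
assert (L : (1 - s * (1 - Cmod p ^ n) <= Cmod (qpoch_fin a p n))%R).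
{ induction n as [|n IH]; [simpl; rewrite Cmod_1; lra|].
  cbn [qpoch_fin]; rewrite Cmod_mult.
  assert (H1 : (1 - Cmod a * Cmod p ^ n <= Cmod (1 - a * p ^ n))%R).
  { pose proof (Cmod_triangle (1 - a * p ^ n) (a * p ^ n)) as T.
    replace (1 - a * p ^ n + a * p ^ n) with (RtoC 1) in T by ring.
    rewrite Cmod_1, Cmod_mult, Cmod_pow in T; lra. }
  assert (Hpn : (0 <= Cmod p ^ n <= 1)%R).
  { split; [apply pow_le, Hp0|]; rewrite <- Cmod_pow; apply Cmod_pow_le_1, Hp. }
  assert (Hpos : (Cmod a * Cmod p ^ n <= 1 / 2 * 1)%R)
    by (pose proof (Rmult_le_pos _ _ Hs0 Hp0); rewrite Rmult_minus_distr_l in Hs;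
        apply Rmult_le_compat; lra).
  assert (HX : (s * (1 - Cmod p ^ n) <= 1 / 2 * 1)%R)
    by (apply Rmult_le_compat; lra).
  apply Rle_trans with ((1 - s * (1 - Cmod p ^ n)) * (1 - Cmod a * Cmod p ^ n))%R.
  - rewrite Hs; simpl.
    assert (0 <= s * (1 - Cmod p ^ n) * (s * (1 - Cmod p) * Cmod p ^ n))%R
      by (repeat apply Rmult_le_pos; lra).
    nra.
  - apply Rmult_le_compat; lra. }
assert (Hpn : (0 <= Cmod p ^ n)%R) by (apply pow_le, Hp0).
nra.
Qed.

Lemma qpoch_inf_neq0 (a p : C) : (Cmod p < 1)%R ->
  (forall n, a * p ^ n <> 1) -> qpoch_inf a p <> 0.
Proof.
intros Hp Ha.
(* This is the threshold of [qpoch_fin_lower]: once |a p^N| is below it, the tail product stays at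
   least 1/2 in modulus, and the N factors before it are nonzero by hypothesis. *)
assert (Hd : (0 < (1 - Cmod p) / 2)%R) by lra.
assert (HL : Ccv (fun n => a * p ^ n) 0).
{ replace (RtoC 0) with (a * 0) by ring.
  apply Ccv_mult; [apply Ccv_const|apply Ccv_pow_0, Hp]. }
destruct (proj1 (is_lim_seq_Reals _ _) HL _ Hd) as [N HN].
specialize (HN N (le_n N)); unfold Rdist in HN.
rewrite Rminus_0_r, Rabs_pos_eq in HN by apply Cmod_ge_0.
replace (a * p ^ N - 0) with (a * p ^ N) in HN by ring.
rewrite (qpoch_inf_split a p N Hp); apply Cmult_neq_0.
- clear HN; induction N as [|N IH]; [exact C1_nz|].
  apply Cmult_neq_0; [exact IH|].
  intros E; apply (Ha N); replace (a * p ^ N) with (1 - (1 - a * p ^ N)) by ring.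
  rewrite E; ring.
- intros E.
  assert (H : (1 / 2 <= 0)%R); [|lra].
  pose proof (Ccv_qpoch_fin (a * p ^ N) p Hp) as Hc; rewrite E in Hc.
  apply (is_lim_seq_le (fun _ => (1 / 2)%R)
    (fun n => Cmod (qpoch_fin (a * p ^ N) p n - 0)) (1 / 2)%R 0%R);
    [|apply is_lim_seq_const|exact Hc].
  intros n; replace (qpoch_fin (a * p ^ N) p n - 0)
    with (qpoch_fin (a * p ^ N) p n) by ring.
  apply qpoch_fin_lower; [exact Hp|].
  apply (Rmult_le_reg_r (1 - Cmod p)); [lra|].
  unfold Rdiv; rewrite Rmult_assoc, Rinv_l by lra; lra.
Qed.

Lemma qpoch_inf_q_neq0 (q : C) : (Cmod q < 1)%R -> qpoch_inf q q <> 0.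
Proof.
intros Hq; apply qpoch_inf_neq0; [exact Hq|]; intros n E.
apply (f_equal Cmod) in E.
rewrite Cmod_mult, Cmod_1 in E.
pose proof (Cmod_pow_le_1 q n Hq); pose proof (Cmod_ge_0 q);
  pose proof (Cmod_ge_0 (q ^ n)); nra.
Qed.

(** Leaving f 0 out of the bound measures how far the sum is from its first term, which is what S(a
    q^k) -> 1 calls for. *)
Lemma Csum_geometric (f : nat -> C) (K rho : R) : (0 <= K)%R -> (0 <= rho < 1)%R ->
  (forall n, (Cmod (f (S n)) <= K * rho ^ n)%R) ->
  exists L : C, Ccv (Csum f) L /\ (Cmod (L - f O) <= K / (1 - rho))%R.
Proof.
intros HK Hr Hf.
assert (E : ex_series (V := C_CompleteNormedModule) f).
{ apply (ex_series_incr_1 (V := C_NormedModule)).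
  apply (ex_series_le (V := C_CompleteNormedModule) _ (fun n => K * rho ^ n)%R);
    [exact Hf|].
  apply (ex_series_scal_l K (fun n => rho ^ n)%R), ex_series_geom.
  rewrite Rabs_pos_eq; lra. }
destruct E as [L HL]; exists L.
assert (HC : Ccv (Csum f) L) by (apply Ccv_is_series, HL).
split; [exact HC|].
apply (Ccv_bound (fun n => Csum f n + - f O)).
- intros n.
  apply Rle_trans with (K * (1 - rho ^ n) / (1 - rho))%R.
  + induction n as [|n IH].
    * rewrite Csum_O; replace (f O + - f O) with (RtoC 0) by ring.
      rewrite Cmod_0; simpl; right; field; lra.
    * rewrite Csum_S.
      replace (Csum f n + f (S n) + - f O) with ((Csum f n + - f O) + f (S n)) by ring.
      eapply Rle_trans; [apply Cmod_triangle|].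
      replace (K * (1 - rho ^ S n) / (1 - rho))%R
        with (K * (1 - rho ^ n) / (1 - rho) + K * rho ^ n)%R by (simpl; field; lra).
      apply Rplus_le_compat; [exact IH|apply Hf].
  + apply Rmult_le_compat_r; [left; apply Rinv_0_lt_compat; lra|].
    assert (0 <= rho ^ n)%R by (apply pow_le; lra); nra.
- apply Ccv_plus; [exact HC|apply Ccv_const].
Qed.

Lemma Cmod_mult_le (u v : C) (A B : R) :
  (Cmod u <= A)%R -> (Cmod v <= B)%R -> (Cmod (u * v) <= A * B)%R.
Proof.
intros Hu Hv; rewrite Cmod_mult; apply Rmult_le_compat; try apply Cmod_ge_0; assumption.
Qed.

Lemma Cmod_1_minus_le (u : C) (A : R) : (Cmod u <= A)%R -> (Cmod (1 - u) <= 1 + A)%R.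
Proof.
intros Hu; eapply Rle_trans; [apply Cmod_triangle|].
rewrite Cmod_1, Cmod_opp; lra.
Qed.

Lemma qpoch_fin3_lower (x y z q : C) : (Cmod q < 1)%R ->
  qpoch_inf x q <> 0 -> qpoch_inf y q <> 0 -> qpoch_inf z q <> 0 ->
  exists K : R, (0 <= K)%R /\
  forall k n, (Cmod (/ (qpoch_fin (x * q ^ k) q n * qpoch_fin (y * q ^ k) q n
    * qpoch_fin (z * q ^ k) q n)) <= K)%R.
Proof.
intros Hq1 Hx Hy Hz.
destruct (qpoch_fin_shift_lower _ q Hq1 Hx) as [X [HX0 HX]].
destruct (qpoch_fin_shift_lower _ q Hq1 Hy) as [Y [HY0 HY]].
destruct (qpoch_fin_shift_lower _ q Hq1 Hz) as [Z [HZ0 HZ]].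
exists (X * Y * Z)%R; split; [repeat apply Rmult_le_pos; lra|].
intros k n.
assert (Hn : forall v, qpoch_inf v q <> 0 -> qpoch_fin (v * q ^ k) q n <> 0).
{ intros v Hv; apply qpoch_fin_neq0, qpoch_inf_shift_neq0; assumption. }
replace (/ (qpoch_fin (x * q ^ k) q n * qpoch_fin (y * q ^ k) q n
    * qpoch_fin (z * q ^ k) q n))
  with (/ qpoch_fin (x * q ^ k) q n * / qpoch_fin (y * q ^ k) q n
    * / qpoch_fin (z * q ^ k) q n)
  by (field; repeat split; apply Hn; assumption).
repeat apply Cmod_mult_le; auto.
Qed.

(** * Convergence of Rogers' series, uniformly along a q^k *)

Section Rogers.
Variables x y z q a : C.
Hypothesis Hq : (0 < Cmod q < 1)%R.
Hypothesis Hconv : (Cmod (a * q * (x * y * z)) < 1)%R.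
Hypothesis Hx : qpoch_inf (a * q * x) q <> 0.
Hypothesis Hy : qpoch_inf (a * q * y) q <> 0.
Hypothesis Hz : qpoch_inf (a * q * z) q <> 0.

Lemma vwp_bound : exists K : R, (0 <= K)%R /\
  forall k n, (Cmod (vwp (a * q ^ k) q n) <= K)%R.
Proof.
destruct Hq as [_ Hq1].
destruct (qpoch_fin_shift_lower q q Hq1 (qpoch_inf_q_neq0 q Hq1)) as [M [HM0 HM]].
set (E := exp (Cmod (a * q) / (1 - Cmod q))).
assert (HE : (0 < E)%R) by apply exp_pos.
pose proof (Cmod_ge_0 a) as Ha.
exists (E * (1 + Cmod a * 1 * 1) * M + 1)%R; split.
{ apply Rplus_le_le_0_compat; [repeat apply Rmult_le_pos|]; lra. }
intros k [|n].
- simpl; rewrite Cmod_1.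
  assert (0 <= E * (1 + Cmod a * 1 * 1) * M)%R by (repeat apply Rmult_le_pos; lra); lra.
- apply Rle_trans with (E * (1 + Cmod a * 1 * 1) * M)%R; [|lra].
  unfold vwp, Cdiv; apply Cmod_mult_le; [apply Cmod_mult_le|].
  + replace (a * q ^ k * q) with (a * q * q ^ k) by ring.
    apply qpoch_fin_shift_bound, Hq1.
  + apply Cmod_1_minus_le; repeat apply Cmod_mult_le; try apply Cmod_pow_le_1, Hq1; lra.
  + replace (qpoch_fin q q (S n)) with (qpoch_fin (q * q ^ 0) q (S n))
      by (f_equal; simpl; ring).
    apply HM.
Qed.

(** The factor (|q|^k)^n comes from (a q^k q)^n; the other k-dependent factors are bounded uniformly
    in k. *)
Lemma rogers_term_bound : exists K rho : R, (0 <= K)%R /\ (0 <= rho < 1)%R /\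
  forall k n, (Cmod (rogers_term x y z q (a * q ^ k) n) <= K * (Cmod q ^ k) ^ n * rho ^ n)%R.
Proof.
destruct vwp_bound as [V [HV0 HV]].
destruct (qpoch_fin3_lower _ _ _ q (proj2 Hq) Hx Hy Hz) as [D [HD0 HD]].
destruct (hpoch3_decay x y z (a * q) q (proj2 Hq) Hconv) as [K [rho [HK [Hr HH]]]].
exists (V * K * D)%R, rho; split; [repeat apply Rmult_le_pos; lra|split; [exact Hr|]].
intros k n.
replace (V * K * D * (Cmod q ^ k) ^ n * rho ^ n)%R
  with (V * (K * rho ^ n * (Cmod q ^ k) ^ n) * D)%R by ring.
unfold rogers_term, Cdiv.
replace (a * q ^ k * q) with (a * q * q ^ k) at 1 by ring.
rewrite Cpow_mult_l, (Cmult_assoc (hpoch3 x y z q n)).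
replace (a * q ^ k * q * x) with (a * q * x * q ^ k) by ring.
replace (a * q ^ k * q * y) with (a * q * y * q ^ k) by ring.
replace (a * q ^ k * q * z) with (a * q * z * q ^ k) by ring.
apply Cmod_mult_le; [apply Cmod_mult_le; [apply HV|apply Cmod_mult_le; [apply HH|]]|apply HD].
rewrite !Cmod_pow; lra.
Qed.

Lemma rogers_rest_cv : Ccv (rogers_rest x y z q a) 0.
Proof.
destruct Hq as [_ Hq1].
destruct (qpoch_fin_shift_lower q q Hq1 (qpoch_inf_q_neq0 q Hq1)) as [M [HM0 HM]].
destruct (qpoch_fin3_lower _ _ _ q Hq1 Hx Hy Hz) as [D [HD0 HD]].
destruct (hpoch3_decay x y z (a * q) q Hq1 Hconv) as [K [rho [HK [Hr HH]]]].
set (E := exp (Cmod (a * q) / (1 - Cmod q))).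
set (w := a * q * (x * y * z)) in *.
set (w' := a * q * (a * q) * (x * y * z)).
apply (Ccv_geometric _
  (E * M * (K * rho) * D * ((1 + Cmod w' * 1) * Cmod (/ (1 - w)))) rho Hr).
intros n.
replace (E * M * (K * rho) * D * ((1 + Cmod w' * 1) * Cmod (/ (1 - w))) * rho ^ n)%R
  with (E * M * (K * rho ^ S n) * D * ((1 + Cmod w' * 1) * Cmod (/ (1 - w))))%R
  by (simpl; ring).
unfold rogers_rest, Cdiv; fold w w'.
apply Cmod_mult_le; [apply Cmod_mult_le; [apply Cmod_mult_le|]|apply Cmod_mult_le].
- rewrite Cmod_opp; apply Cmod_mult_le; [apply qpoch_fin_bound, Hq1|].
  specialize (HM O n); simpl in HM; rewrite Cmult_1_r in HM; exact HM.
- apply HH.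
- specialize (HD O (S n)); simpl in HD; rewrite !Cmult_1_r in HD; exact HD.
- apply Cmod_1_minus_le, Cmod_mult_le; [lra|apply Cmod_pow_le_1, Hq1].
- lra.
Qed.

Lemma rogers_sum_near_1 : exists K : R, forall k, exists L : C,
  Ccv (Csum (rogers_term x y z q (a * q ^ k))) L /\ (Cmod (L - 1) <= K * Cmod q ^ k)%R.
Proof.
destruct rogers_term_bound as [K [rho [HK [Hr HT]]]].
exists (K / (1 - rho))%R; intros k.
assert (Hqk : (0 <= Cmod q ^ k <= 1)%R).
{ rewrite <- Cmod_pow; split; [apply Cmod_ge_0|apply Cmod_pow_le_1, Hq]. }
destruct (Csum_geometric (rogers_term x y z q (a * q ^ k)) (K * Cmod q ^ k) rho)
  as [L [HL HB]].
- apply Rmult_le_pos; lra.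
- exact Hr.
- intros n; eapply Rle_trans; [apply HT|].
  assert (H1 : (0 <= (Cmod q ^ k) ^ n <= 1)%R).
  { split; [apply pow_le|rewrite <- (pow1 n); apply pow_incr]; lra. }
  assert (H2 : (0 <= rho ^ n)%R) by (apply pow_le; lra).
  (* One factor |q|^k is kept from each term of positive index; it becomes the rate in
     [rogers_sum_near_1]. *)
  replace (K * (Cmod q ^ k) ^ S n * rho ^ S n)%R
    with (K * Cmod q ^ k * rho ^ n * ((Cmod q ^ k) ^ n * rho))%R by (simpl; ring).
  rewrite <- (Rmult_1_r (K * Cmod q ^ k * rho ^ n)) at 2.
  apply Rmult_le_compat_l; [repeat apply Rmult_le_pos; lra|nra].
- exists L; split; [exact HL|].
  replace (rogers_term x y z q (a * q ^ k) 0) with (RtoC 1) in HB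
    by (unfold rogers_term, hpoch3; simpl; field; exact C1_nz).
  replace (K / (1 - rho) * Cmod q ^ k)%R with (K * Cmod q ^ k / (1 - rho))%R
    by (field; lra).
  exact HB.
Qed.

End Rogers.

Lemma rogers_sum_step (x y z q a L L' : C) :
  (0 < Cmod q < 1)%R -> (Cmod (a * q * (x * y * z)) < 1)%R ->
  qpoch_inf (a * q * x) q <> 0 -> qpoch_inf (a * q * y) q <> 0 ->
  qpoch_inf (a * q * z) q <> 0 ->
  Ccv (Csum (rogers_term x y z q a)) L ->
  Ccv (Csum (rogers_term x y z q (a * q))) L' ->
  L = rogers_ratio x y z q a * L'.
Proof.
intros Hq Hconv Hx Hy Hz HL HL'.
apply (Ccv_unique _ _ _ HL).
replace (rogers_ratio x y z q a * L') with (rogers_ratio x y z q a * L' + 0) by ring.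
apply (Ccv_ext (fun N => rogers_ratio x y z q a * Csum (rogers_term x y z q (a * q)) N
  + rogers_rest x y z q a N)).
- intros N; symmetry; apply rogers_step;
    try (intros n; apply qpoch_fin_neq0; [apply Hq|assumption]).
  + intros n; apply qpoch_fin_neq0, qpoch_inf_q_neq0; apply Hq.
  + intros E; apply (Rlt_irrefl 1).
    replace (a * q * (x * y * z)) with (1 - (1 - a * q * (x * y * z))) in Hconv by ring.
    rewrite E in Hconv; replace (1 - 0) with (RtoC 1) in Hconv by ring.
    rewrite Cmod_1 in Hconv; exact Hconv.
- apply Ccv_plus; [apply Ccv_mult; [apply Ccv_const|exact HL']|].
  apply rogers_rest_cv; assumption.
Qed.

Lemma qpoch_infs4 (a b c d q : C) : qpoch_infs [a; b; c; d] q
  = qpoch_inf a q * qpoch_inf b q * qpoch_inf c q * qpoch_inf d q.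
Proof. unfold qpoch_infs; simpl; ring. Qed.

(** S(a) = K(a) S(a q) is iterated in the cross-multiplied form S(a) D_k = N_k S(a q^k), with N_k
    and D_k the numerator and denominator products truncated at k. The numerators may vanish; the
    only division by a product is the last one, by the nonzero limit of D_k. *)
Lemma rogers_6phi5 (x y z q a : C) :
  (0 < Cmod q < 1)%R -> (Cmod (a * q * (x * y * z)) < 1)%R ->
  qpoch_inf (a * q * x) q <> 0 -> qpoch_inf (a * q * y) q <> 0 ->
  qpoch_inf (a * q * z) q <> 0 ->
  Ccv (Csum (rogers_term x y z q a))
    (qpoch_infs [a * q; a * q * (x * y); a * q * (x * z); a * q * (y * z)] q
     / qpoch_infs [a * q * x; a * q * y; a * q * z; a * q * (x * y * z)] q).
Proof.
intros Hq Hconv Hx Hy Hz; rewrite !qpoch_infs4.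
pose proof (proj2 Hq) as Hq1.
destruct (rogers_sum_near_1 x y z q a Hq Hconv Hx Hy Hz) as [K HK].
destruct (HK O) as [L [HL _]]; replace (a * q ^ 0) with a in HL by (simpl; ring).
set (Nf := fun k => qpoch_fin (a * q) q k * qpoch_fin (a * q * (x * y)) q k
  * qpoch_fin (a * q * (x * z)) q k * qpoch_fin (a * q * (y * z)) q k).
set (Df := fun k => qpoch_fin (a * q * x) q k * qpoch_fin (a * q * y) q k
  * qpoch_fin (a * q * z) q k * qpoch_fin (a * q * (x * y * z)) q k).
assert (Hw : qpoch_inf (a * q * (x * y * z)) q <> 0).
{ apply qpoch_inf_neq0; [exact Hq1|]; intros n E; apply (f_equal Cmod) in E.
  rewrite Cmod_mult, Cmod_1 in E.
  pose proof (Cmod_pow_le_1 q n Hq1); pose proof (Cmod_ge_0 (q ^ n)).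
  pose proof (Cmod_ge_0 (a * q * (x * y * z))); nra. }
assert (Hk : forall k, exists L', Ccv (Csum (rogers_term x y z q (a * q ^ k))) L' /\
  (Cmod (L' - 1) <= K * Cmod q ^ k)%R /\ L * Df k = Nf k * L').
{ induction k as [|k [L1 [H1 [_ E1]]]].
  - destruct (HK O) as [L' [H1 H2]]; exists L'; split; [exact H1|split; [exact H2|]].
    replace (a * q ^ 0) with a in H1 by (simpl; ring).
    rewrite (Ccv_unique _ _ _ HL H1); unfold Df, Nf; simpl; ring.
  - destruct (HK (S k)) as [L' [H1' H2]]; exists L'; split; [exact H1'|split; [exact H2|]].
    assert (Hs : forall v, a * q ^ k * q * v = a * q * v * q ^ k) by (intros; ring).
    assert (Hi : forall v, qpoch_inf (a * q * v) q <> 0 ->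
      qpoch_inf (a * q ^ k * q * v) q <> 0).
    { intros v Hv; rewrite Hs; apply qpoch_inf_shift_neq0; assumption. }
    assert (Hf : forall v, qpoch_inf (a * q * v) q <> 0 -> 1 - a * q * v * q ^ k <> 0).
    { intros v Hv E; apply (qpoch_fin_neq0 _ q (S k) Hq1 Hv); cbn [qpoch_fin].
      rewrite E; ring. }
    assert (E : L1 = rogers_ratio x y z q (a * q ^ k) * L').
    { apply rogers_sum_step; auto.
      - rewrite Hs, Cmod_mult.
        pose proof (Cmod_pow_le_1 q k Hq1); pose proof (Cmod_ge_0 (q ^ k)).
        pose proof (Cmod_ge_0 (a * q * (x * y * z))); nra.
      - replace (a * q ^ k * q) with (a * q ^ S k) by (simpl; ring); exact H1'. }
    replace (L * Df (S k)) with (L * Df k * ((1 - a * q * x * q ^ k)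
      * (1 - a * q * y * q ^ k) * (1 - a * q * z * q ^ k)
      * (1 - a * q * (x * y * z) * q ^ k))) by (unfold Df; cbn [qpoch_fin]; ring).
    rewrite E1, E; unfold rogers_ratio; rewrite !Hs.
    replace (1 - a * q ^ k * q) with (1 - a * q * q ^ k) by ring.
    unfold Nf; cbn [qpoch_fin]; field; repeat split; apply Hf; assumption. }
assert (HN : Ccv Nf (qpoch_inf (a * q) q * qpoch_inf (a * q * (x * y)) q
  * qpoch_inf (a * q * (x * z)) q * qpoch_inf (a * q * (y * z)) q))
  by (unfold Nf; repeat apply Ccv_mult; apply Ccv_qpoch_fin, Hq1).
assert (HD : Ccv Df (qpoch_inf (a * q * x) q * qpoch_inf (a * q * y) q
  * qpoch_inf (a * q * z) q * qpoch_inf (a * q * (x * y * z)) q))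
  by (unfold Df; repeat apply Ccv_mult; apply Ccv_qpoch_fin, Hq1).
match type of HN with Ccv _ ?n => set (NI := n) in * end.
match type of HD with Ccv _ ?d => set (DI := d) in * end.
assert (HDI : DI <> 0) by (unfold DI; repeat apply Cmult_neq_0; assumption).
replace (NI / DI) with L; [exact HL|].
assert (E : L * DI = NI).
{ apply (Ccv_unique (fun k => L * Df k)); [apply Ccv_mult; [apply Ccv_const|exact HD]|].
  (* The difference equals N_k (S(a q^k) - 1), a bounded factor times O(|q|^k). *)
  assert (Hone : Ccv (fun k => L * Df k + - Nf k) 0).
  { apply (is_lim_seq_le_le (fun _ => 0%R) _
      (fun k => (Cmod (Nf k - NI) + Cmod NI) * (K * Cmod q ^ k))%R).
    - intros k; split; [apply Cmod_ge_0|].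
      destruct (Hk k) as [L' [_ [H2 ->]]].
      replace (Nf k * L' + - Nf k - 0) with (((Nf k - NI) + NI) * (L' - 1)) by ring.
      apply Cmod_mult_le; [apply Cmod_triangle|exact H2].
    - apply is_lim_seq_const.
    - replace (Finite 0) with (Finite ((0 + Cmod NI) * (K * 0))) by (f_equal; ring).
      apply is_lim_seq_mult'.
      + apply is_lim_seq_plus'; [exact HN|apply is_lim_seq_const].
      + apply (is_lim_seq_scal_l _ K 0%R), is_lim_seq_geom.
        rewrite Rabs_pos_eq; [exact Hq1|apply Cmod_ge_0]. }
  apply (Ccv_ext (fun k => (L * Df k + - Nf k) + Nf k)); [intros k; ring|].
  replace NI with (0 + NI) at 1 by ring.
  apply Ccv_plus; assumption. }
rewrite <- E; field; exact HDI.
Qed.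

(** * The case a = 1/q *)

Lemma pow_S_neq1 (q : C) (n : nat) : (Cmod q < 1)%R -> 1 - q ^ S n <> 0.
Proof.
intros Hq E.
apply (qpoch_fin_neq0 q q (S n) Hq (qpoch_inf_q_neq0 q Hq)).
cbn [qpoch_fin]; replace (q * q ^ n) with (q ^ S n) by reflexivity.
rewrite E; ring.
Qed.

Lemma Cmod_inv_1_minus_pow (q : C) (n : nat) : (Cmod q < 1)%R ->
  (Cmod (/ (1 - q ^ S n)) <= / (1 - Cmod q))%R.
Proof.
intros Hq; rewrite Cmod_inv by (apply pow_S_neq1, Hq).
apply Rinv_le_contravar; [lra|].
pose proof (Cmod_triangle (1 - q ^ S n) (q ^ S n)) as T.
replace (1 - q ^ S n + q ^ S n) with (RtoC 1) in T by ring.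
rewrite Cmod_1, Cpow_S, Cmod_mult in T.
pose proof (Cmod_pow_le_1 q n Hq); pose proof (Cmod_ge_0 q).
rewrite Cpow_S; nra.
Qed.

Lemma Ccv_series_term (f : nat -> C) (s : C) : Ccv (Csum f) s -> Ccv f 0.
Proof.
intros H; apply (Ccv_incr f 0 1).
replace (RtoC 0) with (s + - (1) * s) by ring.
apply (Ccv_ext (fun n => Csum f (n + 1)%nat + - (1) * Csum f n)).
- intros n; replace (n + 1)%nat with (S n) by lia; rewrite Csum_S; ring.
- apply Ccv_plus; [apply (Ccv_incr (Csum f) s 1), H|].
  apply Ccv_mult; [apply Ccv_const|exact H].
Qed.

Section Shifted.
Variables x y z q : C.
Hypothesis Hq : (0 < Cmod q < 1)%R.
Hypothesis Hconv : (Cmod (q * (x * y * z)) < 1)%R.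
Hypothesis Hx : qpoch_inf x q <> 0.
Hypothesis Hy : qpoch_inf y q <> 0.
Hypothesis Hz : qpoch_inf z q <> 0.
Hypothesis Hw : 1 - x * y * z <> 0.

(* The terms of [rogers_term] at [a = 1/q] divided by [1 - a q], which vanishes
   there.  The terms [n = 0, 1] are not divisible by it separately but their sum
   is: [shifted_head] is the quotient. *)
Definition shifted_term (n : nat) : C :=
  (1 - q ^ (2 * n - 1)) / ((1 - q ^ (n - 1)) * (1 - q ^ n))
  * (hpoch3 x y z q n / (qpoch_fin x q n * qpoch_fin y q n * qpoch_fin z q n)).

(** By partial fractions this is (1 - 2q)/(1 - q) + x/(1 - x) + y/(1 - y) + z/(1 - z). It is minus
    the derivative in t = a q, at t = 1, of the sum of the terms 0 and 1. *)
Definition shifted_head : C :=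
  - (2 * q - 1 - q * (x + y + z) + (x * y + x * z + y * z) + (q - 2) * (x * y * z))
  / ((1 - q) * (1 - x) * (1 - y) * (1 - z)).

(** The quotient of [rogers_rest] of index n + 1 by 1 - a q at a = 1/q. The index moves by one
    because (a q;q)_0 does not contain the factor 1 - a q. *)
Definition shifted_rest (n : nat) : C :=
  - / (1 - q ^ S n)
  * (hpoch3 x y z q (S (S n))
     / (qpoch_fin x q (S (S n)) * qpoch_fin y q (S (S n)) * qpoch_fin z q (S (S n))))
  * ((1 - x * y * z * q ^ S n) / (1 - x * y * z)).

(** [rogers_ratio] at a = 1/q without its factor 1 - a q. *)
Definition shifted_ratio : C :=
  (1 - x * y) * (1 - x * z) * (1 - y * z)
  / ((1 - x) * (1 - y) * (1 - z) * (1 - x * y * z)).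

Lemma qpoch_inf_neq0_factor (v : C) (n : nat) : qpoch_inf v q <> 0 -> 1 - v * q ^ n <> 0.
Proof.
intros Hv E; apply (qpoch_fin_neq0 v q (S n) (proj2 Hq) Hv); cbn [qpoch_fin].
rewrite E; ring.
Qed.

Lemma qpoch_inf_neq0_factor0 (v : C) : qpoch_inf v q <> 0 -> 1 - v <> 0.
Proof.
intros Hv; pose proof (qpoch_inf_neq0_factor v 0 Hv) as H; simpl in H.
rewrite Cmult_1_r in H; exact H.
Qed.

Lemma shifted_base :
  shifted_head = shifted_ratio * Csum (rogers_term x y z q 1) 1 + shifted_rest 0.
Proof.
pose proof (pow_S_neq1 q 0 (proj2 Hq)) as Hq1; simpl in Hq1; rewrite Cmult_1_r in Hq1.
pose proof (qpoch_inf_neq0_factor0 x Hx); pose proof (qpoch_inf_neq0_factor0 y Hy);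
  pose proof (qpoch_inf_neq0_factor0 z Hz).
pose proof (qpoch_inf_neq0_factor x 1 Hx) as H1x; pose proof (qpoch_inf_neq0_factor y 1 Hy) as H1y;
  pose proof (qpoch_inf_neq0_factor z 1 Hz) as H1z; simpl in H1x, H1y, H1z.
rewrite Cmult_1_r, Cmult_comm in H1x, H1y, H1z.
rewrite Csum_S, Csum_O.
unfold shifted_head, shifted_ratio, shifted_rest, rogers_term, hpoch3; simpl.
rewrite !Cmult_1_r, !Cmult_1_l.
field; repeat split; try assumption; try exact C1_nz.
all: try (rewrite Cmult_comm; assumption).
Qed.

(** The telescoping step at a = 1/q with 1 - a q divided out. With each (v q;q)_(n+2) rewritten
    through (v;q)_(n+2), it becomes a rational identity in U = q^(n+1). *)
Lemma shifted_increment (n : nat) :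
  shifted_rest n + shifted_term (S (S n))
  = shifted_ratio * rogers_term x y z q 1 (S (S n)) + shifted_rest (S n).
Proof.
pose proof (pow_S_neq1 q n (proj2 Hq)) as HU.
pose proof (pow_S_neq1 q (S n) (proj2 Hq)) as HV.
pose proof (qpoch_inf_neq0_factor0 x Hx) as H1x; pose proof (qpoch_inf_neq0_factor0 y Hy) as H1y;
  pose proof (qpoch_inf_neq0_factor0 z Hz) as H1z.
pose proof (qpoch_inf_neq0_factor x (S (S n)) Hx) as HxV;
  pose proof (qpoch_inf_neq0_factor y (S (S n)) Hy) as HyV;
  pose proof (qpoch_inf_neq0_factor z (S (S n)) Hz) as HzV.
assert (Hs : forall v, 1 - v <> 0 ->
  qpoch_fin (1 * q * v) q (S (S n))
  = qpoch_fin v q (S (S n)) * (1 - v * q ^ S (S n)) / (1 - v)).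
{ intros v Hv; replace (1 * q * v) with (v * q) by ring.
  rewrite <- qpoch_fin_shift; field; exact Hv. }
unfold shifted_term, shifted_rest, rogers_term, shifted_ratio, vwp.
rewrite (Hs x H1x), (Hs y H1y), (Hs z H1z).
replace (2 * S (S n) - 1)%nat with (S n + S (S n))%nat by lia.
replace (S (S n) - 1)%nat with (S n) by lia.
replace (2 * S (S n))%nat with (S (S n) + S (S n))%nat by lia.
rewrite !Cpow_add_r.
replace (hpoch3 x y z q (S (S (S n)))) with (hpoch3 x y z q (S (S n))
  * ((x - q ^ S (S n)) * (y - q ^ S (S n)) * (z - q ^ S (S n))))
  by (unfold hpoch3; simpl; ring).
replace (1 * q) with q by ring.
change (qpoch_fin q q (S (S n))) with (qpoch_fin q q (S n) * (1 - q ^ S (S n))).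
change (qpoch_fin x q (S (S (S n)))) with (qpoch_fin x q (S (S n)) * (1 - x * q ^ S (S n))).
change (qpoch_fin y q (S (S (S n)))) with (qpoch_fin y q (S (S n)) * (1 - y * q ^ S (S n))).
change (qpoch_fin z q (S (S (S n)))) with (qpoch_fin z q (S (S n)) * (1 - z * q ^ S (S n))).
pose proof (qpoch_fin_neq0 q q (S n) (proj2 Hq) (qpoch_inf_q_neq0 q (proj2 Hq))) as HQ.
pose proof (qpoch_fin_neq0 x q (S (S n)) (proj2 Hq) Hx) as HX.
pose proof (qpoch_fin_neq0 y q (S (S n)) (proj2 Hq) Hy) as HY.
pose proof (qpoch_fin_neq0 z q (S (S n)) (proj2 Hq) Hz) as HZ.
set (X := qpoch_fin x q (S (S n))) in *.
set (Y := qpoch_fin y q (S (S n))) in *.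
set (Z := qpoch_fin z q (S (S n))) in *.
set (Q := qpoch_fin q q (S n)) in *.
set (H := hpoch3 x y z q (S (S n))) in *.
replace (q ^ S (S n)) with (q * q ^ S n) in * by reflexivity.
set (U := q ^ S n) in *.
field; repeat split; assumption.
Qed.

Lemma shifted_partial_sum (N : nat) :
  shifted_head + Csum (fun k => shifted_term (2 + k)) N
  = shifted_ratio * Csum (rogers_term x y z q 1) (S (S N)) + shifted_rest (S N).
Proof.
induction N as [|N IH].
- rewrite Csum_O, shifted_base, (Csum_S _ 1); change (2 + 0)%nat with 2%nat.
  transitivity (shifted_ratio * Csum (rogers_term x y z q 1) 1
    + (shifted_rest 0 + shifted_term 2)); [ring|].
  rewrite shifted_increment; ring.
- rewrite Csum_S, Cplus_assoc, IH, (Csum_S _ (S (S N))).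
  change (2 + S N)%nat with (S (S (S N))).
  transitivity (shifted_ratio * Csum (rogers_term x y z q 1) (S (S N))
    + (shifted_rest (S N) + shifted_term (S (S (S N))))); [ring|].
  rewrite shifted_increment; ring.
Qed.

Lemma shifted_rest_cv_of_series (s : C) :
  Ccv (Csum (fun k => shifted_term (2 + k))) s -> Ccv shifted_rest 0.
Proof.
intros Hs; apply Ccv_series_term in Hs.
pose proof (proj2 Hq) as Hq1.
set (w := x * y * z) in *.
set (B := ((1 + 1) * / (1 - Cmod q) * ((1 + Cmod w * 1) * Cmod (/ (1 - w))))%R).
apply (Ccv_squeeze _ _ (fun n => Cmod (shifted_term (2 + n) - 0) * B)%R).
- intros n.
  (* The exact quotient of remainder and next term. It is bounded since |1 - q^(2n+3)| >= 1 - |q|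
     and 1 - x y z is a nonzero constant. *)
  replace (shifted_rest n - 0) with ((shifted_term (2 + n) - 0)
    * (- ((1 - q ^ S (S n)) * / (1 - q ^ S (n + S n + 1))
       * ((1 - w * q ^ S n) * / (1 - w))))).
  + apply Cmod_mult_le; [lra|]; rewrite Cmod_opp.
    apply Cmod_mult_le; apply Cmod_mult_le.
    * apply Cmod_1_minus_le, Cmod_pow_le_1, Hq1.
    * apply Cmod_inv_1_minus_pow, Hq1.
    * apply Cmod_1_minus_le, Cmod_mult_le; [lra|apply Cmod_pow_le_1, Hq1].
    * lra.
  + unfold shifted_rest, shifted_term; fold w.
    change (2 + n)%nat with (S (S n)).
    replace (2 * S (S n) - 1)%nat with (S (n + S n + 1)) by lia.
    replace (S (S n) - 1)%nat with (S n) by lia.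
    pose proof (pow_S_neq1 q n Hq1); pose proof (pow_S_neq1 q (S n) Hq1);
      pose proof (pow_S_neq1 q (n + S n + 1) Hq1).
    pose proof (qpoch_fin_neq0 x q (S (S n)) Hq1 Hx).
    pose proof (qpoch_fin_neq0 y q (S (S n)) Hq1 Hy).
    pose proof (qpoch_fin_neq0 z q (S (S n)) Hq1 Hz).
    field; repeat split; assumption.
- replace (Finite 0) with (Finite (0 * B)) by (f_equal; ring).
  apply (is_lim_seq_scal_r _ B 0%R), Hs.
Qed.

Lemma shifted_rest_cv : (Cmod (x * y * z) < 1)%R -> Ccv shifted_rest 0.
Proof.
intros H1; pose proof (proj2 Hq) as Hq1.
destruct (hpoch3_decay x y z 1 q Hq1) as [K [rho [HK [Hr HH]]]];
  [rewrite Cmult_1_l; exact H1|].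
destruct (qpoch_fin3_lower x y z q Hq1 Hx Hy Hz) as [D [HD0 HD]].
set (w := x * y * z) in *.
apply (Ccv_geometric _ (/ (1 - Cmod q) * (K * rho * rho * D)
  * ((1 + Cmod w * 1) * Cmod (/ (1 - w)))) rho Hr).
intros n.
replace (/ (1 - Cmod q) * (K * rho * rho * D)
    * ((1 + Cmod w * 1) * Cmod (/ (1 - w))) * rho ^ n)%R
  with (/ (1 - Cmod q) * (K * rho ^ S (S n) * D)
    * ((1 + Cmod w * 1) * Cmod (/ (1 - w))))%R by (simpl; ring).
unfold shifted_rest; fold w.
apply Cmod_mult_le; [apply Cmod_mult_le|]; [|apply Cmod_mult_le|apply Cmod_mult_le].
- rewrite Cmod_opp; apply Cmod_inv_1_minus_pow, Hq1.
- specialize (HH (S (S n))); rewrite Cpow_1_l, Cmult_1_r in HH; exact HH.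
- specialize (HD O (S (S n))); simpl in HD; rewrite !Cmult_1_r in HD; exact HD.
- apply Cmod_1_minus_le, Cmod_mult_le; [lra|apply Cmod_pow_le_1, Hq1].
- lra.
Qed.

(** The vanishing of the remainder is a premise so that both sources fit: |x y z| < 1, which yields
    convergence, and an assumed convergence, which yields the value. Since (v;q)_oo = (1 - v)(v
    q;q)_oo, [shifted_ratio] turns the product at a = 1 into the one claimed. *)
Lemma shifted_sum : Ccv shifted_rest 0 ->
  Ccv (fun N => shifted_head + Csum (fun k => shifted_term (2 + k)) N)
    (qpoch_infs [q; x * y; x * z; y * z] q / qpoch_infs [x; y; z; x * y * z] q).
Proof.
intros HR; pose proof (proj2 Hq) as Hq1.
assert (Hsh : forall v, qpoch_inf v q = (1 - v) * qpoch_inf (1 * q * v) q).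
{ intros v; rewrite (qpoch_inf_split v q 1 Hq1); simpl.
  f_equal; [ring|f_equal; ring]. }
assert (Hsn : forall v, qpoch_inf v q <> 0 -> qpoch_inf (1 * q * v) q <> 0).
{ intros v Hv E; apply Hv; rewrite Hsh, E; ring. }
assert (Hconv' : (Cmod (1 * q * (x * y * z)) < 1)%R) by (rewrite Cmult_1_l; exact Hconv).
assert (Hwi : qpoch_inf (1 * q * (x * y * z)) q <> 0).
{ apply qpoch_inf_neq0; [exact Hq1|]; intros n E; apply (f_equal Cmod) in E.
  rewrite Cmod_mult, Cmod_1 in E.
  pose proof (Cmod_pow_le_1 q n Hq1); pose proof (Cmod_ge_0 (q ^ n)).
  pose proof (Cmod_ge_0 (1 * q * (x * y * z))); nra. }
pose proof (rogers_6phi5 x y z q 1 Hq Hconv' (Hsn x Hx) (Hsn y Hy) (Hsn z Hz)) as HS.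
apply (Ccv_incr _ _ 2) in HS; apply (Ccv_incr _ _ 1) in HR.
match type of HS with Ccv _ ?l => set (L := l) in * end.
replace (qpoch_infs [q; x * y; x * z; y * z] q / qpoch_infs [x; y; z; x * y * z] q)
  with (shifted_ratio * L + 0).
- apply (Ccv_ext (fun N => shifted_ratio * Csum (rogers_term x y z q 1) (N + 2)
    + shifted_rest (N + 1))).
  + intros N; rewrite shifted_partial_sum.
    replace (N + 2)%nat with (S (S N)) by lia; replace (N + 1)%nat with (S N) by lia.
    reflexivity.
  + apply Ccv_plus; [apply Ccv_mult; [apply Ccv_const|exact HS]|exact HR].
- unfold L; rewrite !qpoch_infs4, (Hsh x), (Hsh y), (Hsh z), (Hsh (x * y * z)),
    (Hsh (x * y)), (Hsh (x * z)), (Hsh (y * z)).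
  replace (qpoch_inf (1 * q) q) with (qpoch_inf q q) by (f_equal; ring).
  unfold shifted_ratio; field; repeat split; auto; apply qpoch_inf_neq0_factor0; assumption.
Qed.

End Shifted.

(** * The bilateral series and the theorem *)

Lemma Cinv_zero : / RtoC 0 = RtoC 0.
Proof. unfold Cinv; apply injective_projections; simpl; unfold Rdiv; ring. Qed.

Lemma Cinv_one : / RtoC 1 = RtoC 1.
Proof. field; exact C1_nz. Qed.

(** The case u = 0 matters: for b = q^(-j) the factorial (q/b;q)_(-m) with m > j is the inverse of
    0, and inverting it again gives the correct zero term. *)
Lemma Cinv_involutive (u : C) : / / u = u.
Proof.
destruct (Ceq_dec u 0) as [->|H]; [rewrite !Cinv_zero; reflexivity|].
field; exact H.
Qed.

Lemma Cinv_mul (u v : C) : / (u * v) = / u * / v.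
Proof.
destruct (Ceq_dec u 0) as [->|Hu]; [rewrite Cmult_0_l, !Cinv_zero; ring|].
destruct (Ceq_dec v 0) as [->|Hv]; [rewrite Cmult_0_r, !Cinv_zero; ring|].
field; split; assumption.
Qed.

Lemma qpochz_of_nat (a q : C) (n : nat) : qpochz a q (Z.of_nat n) = qpoch_fin a q n.
Proof.
destruct n as [|n]; [reflexivity|].
unfold qpochz; simpl Z.of_nat; cbv iota; rewrite SuccNat2Pos.id_succ; reflexivity.
Qed.

Lemma Cpowz_of_nat (u : C) (n : nat) : Cpowz u (Z.of_nat n) = u ^ n.
Proof.
destruct n as [|n]; [reflexivity|].
unfold Cpowz; simpl Z.of_nat; cbv iota; rewrite SuccNat2Pos.id_succ; reflexivity.
Qed.

Lemma Cpowz_opp_of_nat (u : C) (n : nat) : Cpowz u (- Z.of_nat (S n)) = / u ^ S n.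
Proof.
unfold Cpowz; simpl Z.of_nat; simpl Z.opp; cbv iota.
rewrite SuccNat2Pos.id_succ; reflexivity.
Qed.

Lemma qpochz_opp_of_nat (a q : C) (n : nat) :
  qpochz a q (- Z.of_nat (S n)) = / qpoch_fin (a * / q ^ S n) q (S n).
Proof.
unfold qpochz, Cpowz; simpl Z.of_nat; simpl Z.opp; cbv iota.
rewrite SuccNat2Pos.id_succ; reflexivity.
Qed.

Lemma qpoch_fin_div_S (a q : C) (n : nat) : q <> 0 ->
  qpoch_fin (a * / q ^ S n) q (S n)
  = (1 - a * / q ^ S n) * qpoch_fin (a * / q ^ n) q n.
Proof.
intros Hq; change (qpoch_fin (a * / q ^ S n) q (S n))
  with (qpoch_fin (a * / q ^ S n) q (1 + n)).
rewrite qpoch_fin_split; f_equal; [simpl; ring|].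
f_equal; simpl; field; split; [apply Cpow_nz|]; exact Hq.
Qed.

Lemma qpochz_opp_ratio (b q : C) (n : nat) :
  b <> 0 -> q <> 0 -> (forall m, qpoch_fin (q / b) q m <> 0) ->
  qpochz b q (- Z.of_nat (S n)) / qpochz (q / b) q (- Z.of_nat (S n))
  = (q / b) ^ S n * (hpoch (1 / b) q (S n) / qpoch_fin (q / b) q (S n)).
Proof.
intros Hb Hq H.
rewrite !qpochz_opp_of_nat; unfold Cdiv at 1; rewrite Cinv_involutive.
generalize (S n) as m; clear n; intros m.
(* The reflection is proved cross-multiplied since (q^(1-m)/b;q)_m may vanish. The other factor
   cannot, because 1 - b q^(-m-1) is a nonzero multiple of 1 - q^(m+1)/b. *)
assert (HF : qpoch_fin (b * / q ^ m) q m <> 0 /\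
  qpoch_fin (q / b * / q ^ m) q m * qpoch_fin (q / b) q m
  = (q / b) ^ m * hpoch (1 / b) q m * qpoch_fin (b * / q ^ m) q m).
{ induction m as [|m [IH1 IH2]]; [split; [exact C1_nz|simpl; ring]|].
  assert (Hm : 1 - q / b * q ^ m <> 0).
  { intros E; apply (H (S m)); cbn [qpoch_fin]; rewrite E; ring. }
  assert (Hqm : q ^ m <> 0) by (apply Cpow_nz, Hq).
  rewrite !qpoch_fin_div_S by exact Hq; split.
  - apply Cmult_neq_0; [|exact IH1].
    intros E; apply Hm.
    replace (1 - q / b * q ^ m)
      with (- (1 - b * / q ^ S m) * (q ^ S m / b)) by (simpl; field; auto).
    rewrite E; ring.
  - cbn [qpoch_fin hpoch].
    transitivity ((1 - q / b * / q ^ S m) * (1 - q / b * q ^ m)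
      * (qpoch_fin (q / b * / q ^ m) q m * qpoch_fin (q / b) q m)); [ring|].
    rewrite IH2; simpl; field; auto. }
destruct HF as [HF1 HF2].
transitivity (qpoch_fin (q / b * / q ^ m) q m * qpoch_fin (q / b) q m
  / (qpoch_fin (q / b) q m * qpoch_fin (b * / q ^ m) q m)).
- field; auto.
- rewrite HF2; field; auto.
Qed.

Lemma qpoch_infs4_neq0 (a b c d q : C) : qpoch_infs [a; b; c; d] q <> 0 ->
  qpoch_inf a q <> 0 /\ qpoch_inf b q <> 0 /\ qpoch_inf c q <> 0 /\ qpoch_inf d q <> 0.
Proof.
rewrite qpoch_infs4; intros H; repeat split; intros E; apply H; rewrite E; ring.
Qed.

(** The term of index n >= 0 is u n and that of index -n is u n * q^n. For n >= 1 they add up to (1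
    + q^n) u n, and 1 + q^n = (1 - q^(2n))/(1 - q^n) is the very-well-poised factor at a = 1. *)
Lemma bilateral_3psi3 (q b c d : C) : (0 < Cmod q < 1)%R ->
  b <> 0 -> c <> 0 -> d <> 0 -> (Cmod (q / (b * c * d)) < 1)%R ->
  qpoch_infs [q / b; q / c; q / d; q / (b * c * d)] q <> 0 ->
  is_bilateral_series
    (fun n : Z =>
       qpochzs [b; c; d] q n / qpochzs [q / b; q / c; q / d] q n
       * Cpowz (q / (b * c * d)) n)
    (qpoch_infs [q; q / (b * c); q / (b * d); q / (c * d)] q
     / qpoch_infs [q / b; q / c; q / d; q / (b * c * d)] q).
Proof.
intros Hq Hb Hc Hd Hconv Hnz; pose proof (proj2 Hq) as Hq1.
assert (Hq0 : q <> 0) by (apply Cmod_gt_0, Hq).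
destruct (qpoch_infs4_neq0 _ _ _ _ _ Hnz) as [Hib [Hic [Hid _]]].
set (u := fun n => hpoch3 (1 / b) (1 / c) (1 / d) q n * q ^ n
  / (qpoch_fin (q / b) q n * qpoch_fin (q / c) q n * qpoch_fin (q / d) q n)).
assert (Hpos : forall n : nat,
  qpochzs [b; c; d] q (Z.of_nat n) / qpochzs [q / b; q / c; q / d] q (Z.of_nat n)
  * Cpowz (q / (b * c * d)) (Z.of_nat n) = u n).
{ intros n; unfold qpochzs; simpl; rewrite Cpowz_of_nat, !qpochz_of_nat.
  replace (q / (b * c * d)) with (q * (1 / b) * (1 / c) * (1 / d))
    by (field; repeat split; assumption).
  unfold u, hpoch3; rewrite !Cpow_mult_l, !hpoch_inv by assumption.
  field; repeat split; apply qpoch_fin_neq0; assumption. }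
assert (Hneg : forall n : nat,
  qpochzs [b; c; d] q (- Z.of_nat (S n)) / qpochzs [q / b; q / c; q / d] q (- Z.of_nat (S n))
  * Cpowz (q / (b * c * d)) (- Z.of_nat (S n)) = u (S n) * q ^ S n).
{ intros n; rewrite Cpowz_opp_of_nat.
  set (m := (- Z.of_nat (S n))%Z).
  assert (E : qpochzs [b; c; d] q m / qpochzs [q / b; q / c; q / d] q m
    = (qpochz b q m / qpochz (q / b) q m) * (qpochz c q m / qpochz (q / c) q m)
      * (qpochz d q m / qpochz (q / d) q m)).
  { unfold qpochzs; simpl; unfold Cdiv; rewrite !Cmult_1_r, !Cinv_mul; ring. }
  rewrite E; unfold m; rewrite !qpochz_opp_ratio;
    try assumption; try (intros; apply qpoch_fin_neq0; assumption).
  (* The three reflections produce the powers of q/b, q/c and q/d; dividing by the power of q/(bcd)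
     leaves q^(2n), that is q^n beyond the one in u. *)
  replace (q / (b * c * d)) with ((q / b) * (q / c) * (q / d) * (/ q * / q))
    by (field; repeat split; assumption).
  unfold u, hpoch3; rewrite !Cpow_mult_l, !Cpow_inv by assumption.
  assert (Hp : forall v : C, v <> 0 -> (q / v) ^ S n <> 0).
  { intros v Hv; apply Cpow_nz; intros E'; apply Hq0.
    replace q with (q / v * v) by (field; exact Hv); rewrite E'; ring. }
  pose proof (Cpow_nz q (S n) Hq0).
  field; repeat split; auto; apply qpoch_fin_neq0; assumption. }
destruct (hpoch3_decay (1 / b) (1 / c) (1 / d) q q Hq1) as [K [rho [HK [Hr HH]]]].
{ replace (q * (1 / b * (1 / c) * (1 / d))) with (q / (b * c * d))
    by (field; repeat split; assumption).
  exact Hconv. }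
destruct (qpoch_fin3_lower _ _ _ q Hq1 Hib Hic Hid) as [D [HD0 HD]].
assert (Hu : forall n, (Cmod (u n) <= K * D * rho ^ n)%R).
{ intros n; replace (K * D * rho ^ n)%R with (K * rho ^ n * D)%R by ring.
  unfold u; apply Cmod_mult_le; [apply HH|].
  specialize (HD O n); simpl in HD; rewrite !Cmult_1_r in HD; exact HD. }
assert (HKD : (0 <= K * D * rho)%R) by (repeat apply Rmult_le_pos; lra).
destruct (Csum_geometric u (K * D * rho) rho HKD Hr) as [s1 [Hs1 _]].
{ intros n; replace (K * D * rho * rho ^ n)%R with (K * D * rho ^ S n)%R by (simpl; ring).
  apply Hu. }
assert (HKD2 : (0 <= K * D * rho * rho)%R) by (apply Rmult_le_pos; lra).
destruct (Csum_geometric (fun n => u (S n) * q ^ S n) (K * D * rho * rho) rho HKD2 Hr)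
  as [s2 [Hs2 _]].
{ intros n.
  replace (K * D * rho * rho * rho ^ n)%R with (K * D * rho ^ S (S n) * 1)%R
    by (simpl; ring).
  apply Cmod_mult_le; [apply Hu|apply Cmod_pow_le_1, Hq1]. }
exists s1, s2; split; [|split].
- apply Ccv_is_series; apply (Ccv_ext (Csum u)); [|exact Hs1].
  intros n; unfold Csum; apply sum_n_ext; intros k; symmetry; apply Hpos.
- apply Ccv_is_series; apply (Ccv_ext (Csum (fun n => u (S n) * q ^ S n))); [|exact Hs2].
  intros n; unfold Csum; apply sum_n_ext; intros k; symmetry; apply Hneg.
- assert (Ex : forall v : C, v <> 0 -> 1 * q * (1 / v) = q / v) by (intros; field; assumption).
  assert (Exy : forall v w : C, v <> 0 -> w <> 0 -> 1 * q * (1 / v * (1 / w)) = q / (v * w))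
    by (intros; field; auto).
  assert (Exyz : 1 * q * (1 / b * (1 / c) * (1 / d)) = q / (b * c * d))
    by (field; auto).
  pose proof (rogers_6phi5 (1 / b) (1 / c) (1 / d) q 1 Hq) as HR.
  rewrite !Ex, !Exy, Exyz, Cmult_1_l in HR by assumption.
  specialize (HR Hconv Hib Hic Hid).
  (* The negative half starts at index -1, so its n-th partial sum pairs with the (n + 1)-st one of
     the other half. *)
  apply (Ccv_incr _ _ 1) in HR; apply (Ccv_incr _ _ 1) in Hs1.
  apply (Ccv_unique _ _ _ HR).
  apply (Ccv_ext (fun n => Csum u (n + 1) + Csum (fun n => u (S n) * q ^ S n) n));
    [|apply Ccv_plus; assumption].
  assert (Hterm : forall n,
    u (S n) + u (S n) * q ^ S n = rogers_term (1 / b) (1 / c) (1 / d) q 1 (S n)).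
  { intros n; unfold u, rogers_term, vwp.
    rewrite !Ex by assumption.
    replace (1 * q) with q by ring.
    replace (2 * S n)%nat with (S n + S n)%nat by lia; rewrite Cpow_add_r.
    change (qpoch_fin q q (S n)) with (qpoch_fin q q n * (1 - q ^ S n)).
    pose proof (qpoch_fin_neq0 q q n Hq1 (qpoch_inf_q_neq0 q Hq1)).
    pose proof (pow_S_neq1 q n Hq1).
    field; repeat split; try assumption; apply qpoch_fin_neq0; assumption. }
  assert (H0 : u O = rogers_term (1 / b) (1 / c) (1 / d) q 1 0).
  { unfold u, rogers_term, hpoch3; simpl; field; exact C1_nz. }
  intros n; replace (n + 1)%nat with (S n) by lia.
  induction n as [|n IH].
  + rewrite !Csum_S, !Csum_O, <- Hterm, H0; ring.
  + rewrite (Csum_S u), (Csum_S (fun n => _ * _)), (Csum_S (rogers_term _ _ _ _ _)),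
      <- IH, <- Hterm; ring.
Qed.

(** The summand t is abstract to cover the three forms in the theorem, and is compared from index 2
    on only: at 0 and 1 a denominator is zero. *)
Lemma shifted_6phi5 (x y z q : C) (t : nat -> C) :
  (0 < Cmod q < 1)%R -> (Cmod (q * (x * y * z)) < 1)%R ->
  qpoch_infs [x; y; z; x * y * z] q <> 0 ->
  (forall n, t (2 + n)%nat = shifted_term x y z q (2 + n)) ->
  ((Cmod (x * y * z) < 1)%R -> exists S : C, is_series_from 2 t S) /\
  (forall S : C, is_series_from 2 t S -> shifted_head x y z q + S
    = qpoch_infs [q; x * y; x * z; y * z] q / qpoch_infs [x; y; z; x * y * z] q).
Proof.
intros Hq Hconv Hnz Ht.
destruct (qpoch_infs4_neq0 _ _ _ _ _ Hnz) as [Hx [Hy [Hz Hw]]].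
apply (qpoch_inf_neq0_factor0 q Hq) in Hw.
pose proof (Csum_ext _ _ Ht) as HE.
split.
- intros H1.
  pose proof (shifted_sum x y z q Hq Hconv Hx Hy Hz Hw
    (shifted_rest_cv x y z q Hq Hx Hy Hz H1)) as HS.
  match type of HS with Ccv _ ?l => exists (l + - shifted_head x y z q) end.
  apply Ccv_is_series.
  refine (Ccv_ext _ _ _ _ (Ccv_plus _ _ _ _ HS (Ccv_const _))).
  intros n; cbv beta; rewrite <- HE; ring.
- intros S HS; apply Ccv_is_series in HS.
  assert (HS' : Ccv (Csum (fun k => shifted_term x y z q (2 + k))) S)
    by (apply (Ccv_ext _ _ _ HE HS)).
  apply (Ccv_unique (fun N => shifted_head x y z q
    + Csum (fun k => shifted_term x y z q (2 + k)) N)).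
  + apply Ccv_plus; [apply Ccv_const|exact HS'].
  + apply shifted_sum; try assumption.
    apply (shifted_rest_cv_of_series x y z q Hq Hx Hy Hz Hw S HS').
Qed.

(** Among the first 2n factors of (x^2;q)_oo, those of even index are 1 - (x q^j)^2 = (1 - x q^j)(1
    + x q^j), and those of odd index form (q x^2;q^2)_n. *)
Lemma qpoch_inf_sqr (x q : C) : (Cmod q < 1)%R ->
  qpoch_inf (x * x) q = qpoch_inf x q * qpoch_inf (- x) q * qpoch_inf (q * (x * x)) (q ^ 2).
Proof.
intros Hq.
assert (Hq2 : (Cmod (q ^ 2) < 1)%R).
{ rewrite Cmod_pow; pose proof (Cmod_ge_0 q); simpl; nra. }
apply (Ccv_unique (fun n => qpoch_fin (x * x) q (n + n))).
- intros P HP.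
  destruct (Ccv_qpoch_fin (x * x) q Hq P HP) as [N HN].
  exists N; intros n Hn; apply HN; lia.
- apply (Ccv_ext (fun n => qpoch_fin x q n * qpoch_fin (- x) q n
    * qpoch_fin (q * (x * x)) (q ^ 2) n)).
  + induction n as [|n IH]; [simpl; ring|].
    replace (S n + S n)%nat with (S (S (n + n))) by lia.
    cbn [qpoch_fin]; rewrite <- IH, <- Cpow_mult_r.
    replace (2 * n)%nat with (n + n)%nat by lia; rewrite (Cpow_S q (n + n)), !Cpow_add_r.
    ring.
  + repeat apply Ccv_mult; apply Ccv_qpoch_fin; assumption.
Qed.

Lemma qpoch_fin_0 (q : C) (n : nat) : qpoch_fin 0 q n = 1.
Proof. induction n as [|n IH]; [reflexivity|cbn [qpoch_fin]; rewrite IH; ring]. Qed.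

Lemma qpoch_inf_0 (q : C) : (Cmod q < 1)%R -> qpoch_inf 0 q = 1.
Proof.
intros Hq; apply (Ccv_unique (qpoch_fin 0 q)); [apply Ccv_qpoch_fin, Hq|].
apply (Ccv_ext (fun _ => RtoC 1)); [intros n; symmetry; apply qpoch_fin_0|apply Ccv_const].
Qed.

Lemma hpoch3_0 (q : C) (n : nat) :
  hpoch3 0 0 0 q n = (- 1) ^ n * q ^ (3 * n * (n - 1) / 2).
Proof.
induction n as [|n IH]; [unfold hpoch3; simpl; ring|].
replace (3 * S n * (S n - 1) / 2)%nat with (3 * n * (n - 1) / 2 + 3 * n)%nat.
- transitivity (hpoch3 0 0 0 q n * (- (q ^ n * q ^ n * q ^ n))).
  + unfold hpoch3; cbn [hpoch]; ring.
  + rewrite IH; replace (3 * n)%nat with (n + n + n)%nat by lia.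
    rewrite !Cpow_add_r, Cpow_S; ring.
(* Moving 3n under the division as 3n * 2 avoids any parity argument. *)
- rewrite <- Nat.div_add by lia; f_equal; destruct n as [|n]; [reflexivity|].
  replace (S n - 1)%nat with n by lia; replace (S (S n) - 1)%nat with (S n) by lia; ring.
Qed.

Theorem theorem3p4 : forall q : C, (0 < Cmod q < 1)%R ->
  (* (1) *)
  (forall b c d : C, b <> 0 -> c <> 0 -> d <> 0 ->
    (Cmod (q / (b * c * d)) < 1)%R ->
    qpoch_infs [q / b; q / c; q / d; q / (b * c * d)] q <> 0 ->
    is_bilateral_series
      (fun n : Z =>
         qpochzs [b; c; d] q n / qpochzs [q / b; q / c; q / d] q n
         * Cpowz (q / (b * c * d)) n)
      (qpoch_infs [q; q / (b * c); q / (b * d); q / (c * d)] q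
       / qpoch_infs [q / b; q / c; q / d; q / (b * c * d)] q))
  /\
  (* (2) *)
  (forall b c d : C, b <> 0 -> c <> 0 -> d <> 0 ->
    (Cmod (q / (b * c * d)) < 1)%R ->
    qpoch_infs [1 / b; 1 / c; 1 / d; 1 / (b * c * d)] q <> 0 ->
    let C0 :=
      (2 * b * c * d * q - b * c * d - b * c * q - b * d * q - c * d * q
       + b + c + d + q - 2)
      / ((1 - q) * (1 - b) * (1 - c) * (1 - d)) in
    let t := fun n : nat =>
      (1 - q ^ (2 * n - 1)) / ((1 - q ^ (n - 1)) * (1 - q ^ n))
      * (qpochzs [b; c; d] q (Z.of_nat n)
         / qpochzs [1 / b; 1 / c; 1 / d] q (Z.of_nat n))
      * (1 / (b * c * d)) ^ n in
    ((Cmod (1 / (b * c * d)) < 1)%R -> exists S : C, is_series_from 2 t S) /\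
    (forall S : C, is_series_from 2 t S ->
      C0 + S =
      qpoch_infs [q; 1 / (b * c); 1 / (b * d); 1 / (c * d)] q
      / qpoch_infs [1 / b; 1 / c; 1 / d; 1 / (b * c * d)] q))
  /\
  (* (3), first identity *)
  (forall b : C, b <> 0 ->
    (Cmod (q / b ^ 3) < 1)%R ->
    qpoch_infs [1 / b; 1 / b ^ 3] q <> 0 ->
    let t := fun n : nat =>
      (1 - q ^ (2 * n - 1)) / ((1 - q ^ (n - 1)) * (1 - q ^ n))
      * (qpochz b q (Z.of_nat n) ^ 3 / qpochz (1 / b) q (Z.of_nat n) ^ 3)
      * (1 / b) ^ (3 * n) in
    ((Cmod (1 / b ^ 3) < 1)%R -> exists S : C, is_series_from 2 t S) /\
    (forall S : C, is_series_from 2 t S ->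
      S = qpoch_inf q q
          * (qpoch_inf (- 1 / b) q ^ 3 * qpoch_inf (q / b ^ 2) (q ^ 2) ^ 3
             / qpoch_inf (1 / b ^ 3) q)
          + (- (2) * b * q + b - q + 2) / ((1 - b) * (1 - q))))
  /\
  (* (3), second identity *)
  is_series_from 2
    (fun n : nat =>
       (1 - q ^ (2 * n - 1)) / ((1 - q ^ (n - 1)) * (1 - q ^ n))
       * (- 1) ^ n * q ^ (3 * n * (n - 1) / 2))
    (qpoch_inf q q - (1 - 2 * q) / (1 - q)).
Proof.
intros q Hq; pose proof (proj2 Hq) as Hq1.
pose proof (pow_S_neq1 q 0 Hq1) as H1q; rewrite Cpow_1_r in H1q.
split; [|split; [|split]].
- intros b c d; apply bilateral_3psi3, Hq.
- intros b c d Hb Hc Hd Hconv Hnz C0 t.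
  assert (Exy : forall u v : C, u <> 0 -> v <> 0 -> 1 / (u * v) = 1 / u * (1 / v))
    by (intros; field; auto).
  assert (Exyz : 1 / (b * c * d) = 1 / b * (1 / c) * (1 / d)) by (field; auto).
  destruct (qpoch_infs4_neq0 _ _ _ _ _ Hnz) as [Hx [Hy [Hz _]]].
  rewrite Exyz, !Exy in * by assumption.
  assert (Hconv' : (Cmod (q * (1 / b * (1 / c) * (1 / d))) < 1)%R).
  { rewrite <- Exyz; replace (q * (1 / (b * c * d))) with (q / (b * c * d))
      by (field; auto); exact Hconv. }
  (* The two differ by clearing bcd, with signs from 1 - 1/b = -(1 - b)/b. *)
  replace C0 with (shifted_head (1 / b) (1 / c) (1 / d) q).
  + apply shifted_6phi5; try assumption.
    intros n; unfold t, shifted_term, qpochzs, hpoch3; cbn [map fold_right].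
    rewrite Exyz, !qpochz_of_nat, !hpoch_inv, !Cpow_mult_l by assumption.
    set (m := (2 + n)%nat); unfold Cdiv; rewrite !Cinv_mul, Cinv_one; ring.
  + pose proof (qpoch_inf_neq0_factor0 q Hq _ Hx); pose proof (qpoch_inf_neq0_factor0 q Hq _ Hy);
      pose proof (qpoch_inf_neq0_factor0 q Hq _ Hz).
    assert (Hn : forall v : C, v <> 0 -> 1 - 1 / v <> 0 -> 1 - v <> 0 /\ v - 1 <> 0).
    { intros v Hv H'; split; intros E; apply H'.
      - replace (1 - 1 / v) with (- (1 - v) / v) by (field; exact Hv).
        rewrite E; field; exact Hv.
      - replace (1 - 1 / v) with ((v - 1) / v) by (field; exact Hv).
        rewrite E; field; exact Hv. }
    unfold C0, shifted_head; field; repeat split;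
      first [assumption|apply Hn; assumption].
- intros b Hb Hconv Hnz t.
  assert (Exyz : 1 / b ^ 3 = 1 / b * (1 / b) * (1 / b)) by (simpl; field; exact Hb).
  unfold qpoch_infs in Hnz; cbn [map fold_right] in Hnz.
  assert (Hx : qpoch_inf (1 / b) q <> 0) by (intros E; apply Hnz; rewrite E; ring).
  assert (Hw : qpoch_inf (1 / b ^ 3) q <> 0) by (intros E; apply Hnz; rewrite E; ring).
  rewrite Exyz in *.
  assert (Hconv' : (Cmod (q * (1 / b * (1 / b) * (1 / b))) < 1)%R).
  { rewrite <- Exyz; replace (q * (1 / b ^ 3)) with (q / b ^ 3)
      by (simpl; field; exact Hb); exact Hconv. }
  destruct (shifted_6phi5 (1 / b) (1 / b) (1 / b) q t Hq Hconv') as [HA HB].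
  { rewrite qpoch_infs4; repeat apply Cmult_neq_0; assumption. }
  { intros n; unfold t, shifted_term, hpoch3.
    rewrite !qpochz_of_nat, !hpoch_inv by assumption.
    rewrite (Nat.mul_comm 3), Cpow_mult_r.
    pose proof (qpoch_fin_neq0 _ q (2 + n) Hq1 Hx) as HX.
    set (m := (2 + n)%nat) in *; set (X := qpoch_fin (1 / b) q m) in *.
    unfold Cdiv; rewrite !Cinv_mul, <- (Cpow_inv X) by exact HX; ring. }
  split; [exact HA|].
  intros S HS; specialize (HB S HS).
  rewrite !qpoch_infs4, (qpoch_inf_sqr (1 / b) q Hq1) in HB.
  replace (- (1 / b)) with (- 1 / b) in HB by (field; exact Hb).
  replace (q * (1 / b * (1 / b))) with (q / b ^ 2) in HB by (simpl; field; exact Hb).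
  pose proof (qpoch_inf_neq0_factor0 q Hq _ Hx) as H1.
  assert (H1b : 1 - b <> 0).
  { intros E; apply H1; replace (1 - 1 / b) with (- (1 - b) / b) by (field; exact Hb).
    rewrite E; field; exact Hb. }
  replace S with (shifted_head (1 / b) (1 / b) (1 / b) q + S
    + - shifted_head (1 / b) (1 / b) (1 / b) q) by ring.
  rewrite HB; f_equal.
  + field; auto.
  (* At x = y = z = 1/b the head is (1 - 2q)/(1 - q) - 3/(1 - b), which explains the single factor 1
     - b in the constant. *)
  + unfold shifted_head; field; repeat split; try assumption.
    intros E; apply H1b; replace (1 - b) with (- (b - 1)) by ring; rewrite E; ring.
- assert (Hi0 : qpoch_inf 0 q <> 0) by (rewrite qpoch_inf_0 by exact Hq1; exact C1_nz).
  assert (H000 : RtoC 0 * 0 * 0 = 0) by ring.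
  destruct (shifted_6phi5 0 0 0 q (fun n : nat =>
       (1 - q ^ (2 * n - 1)) / ((1 - q ^ (n - 1)) * (1 - q ^ n))
       * (- 1) ^ n * q ^ (3 * n * (n - 1) / 2)) Hq) as [HA HB].
  { rewrite H000, Cmult_0_r, Cmod_0; lra. }
  { rewrite qpoch_infs4, H000; repeat apply Cmult_neq_0; assumption. }
  { intros n; unfold shifted_term; rewrite hpoch3_0, !qpoch_fin_0.
    unfold Cdiv at 3; rewrite !Cmult_1_r, Cinv_one; ring. }
  (* Here x y z = 0, so convergence is unconditional. *)
  rewrite H000, Cmod_0 in HA; destruct (HA Rlt_0_1) as [S HS].
  specialize (HB S HS).
  replace (qpoch_inf q q - (1 - 2 * q) / (1 - q)) with S; [exact HS|].
  rewrite !qpoch_infs4, H000, !Cmult_0_r, qpoch_inf_0 in HB by exact Hq1.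
  replace S with (shifted_head 0 0 0 q + S + - shifted_head 0 0 0 q) by ring.
  rewrite HB; unfold shifted_head; field; exact H1q.
Qed.
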